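(* Consider, for each $N\ge 1$, the closed network with $N$ units, a hub with state-dependent service governed by $G$, and a single satellite station with service rate $\mu N$, as described in the context, with all networks ($N\ge1$) defined on a common probability space and all $N$ units in the hub at time $0$. Let $Q_N(t)$ be the number of units in the satellite station at time $t$, let $\overline{Q}_N(t)=N-Q_N(t)$ be the number of units in the hub, and put $q_N(t)=Q_N(t)/N$, $\overline{q}_N(t)=\overline{Q}_N(t)/N$. If $\mu<\lambda$ (the satellite station is a bottleneck), then for every $t\ge 0$, almost surely, $$\lim_{N\to\infty}\overline{q}_N(t)=\overline{q}(t):=1-\frac{\lambda-\mu}{\lambda}\left(1-\mathrm{e}^{-\lambda t}\right),$$ equivalently $$\lim_{N\to\infty}q_N(t)=\left(1-\frac{\mu}{\lambda}\right)\left(1-\mathrm{e}^{-\lambda t}\right),$$ and this almost sure convergence is uniform in $t$ on every bounded subset of $[0,\infty)$.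
   Context: $G$ is the probability distribution function of a positive random variable with mean $\int_0^\infty x\,\mathrm{d}G(x)=\frac1\lambda$ ($\lambda>0$) and finite second moment $r=\int_0^\infty x^2\,\mathrm{d}G(x)$ satisfying $r>\frac{2}{\lambda^2}$. The network contains $N$ units, which circulate between a hub and one satellite station. The hub is a single-server queueing system with state-dependent service: if immediately before the start of a service the number of units in the hub equals $K$ ($1\le K\le N$), then the duration of this service has distribution function $F_K(x)=G(Kx)$ (hence mean $\frac{1}{K\lambda}$); given the value of $K$ at its start, a service time is independent of the past, and its distribution does not change if units arrive at the hub during it. After service completion in the hub a unit goes to the satellite station. The satellite station is a single-server queue with infinite waiting room and independent exponentially distributed service times with parameter $\mu N$ ($\mu>0$), independent of the hub service times. After service in the satellite station a unit returns to the hub. *)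

(* Defs.v *)
From HB Require Import structures.
From mathcomp Require Import all_boot all_order all_algebra finmap.
From mathcomp Require Import all_classical all_reals all_analysis.

Set Implicit Arguments.
Unset Strict Implicit.
Unset Printing Implicit Defensive.

Import Order.TTheory GRing.Theory Num.Theory.
Import numFieldNormedType.Exports.
Local Open Scope classical_set_scope.
Local Open Scope ring_scope.

(** Sample paths.  Services are numbered from 0 at either station, in the order
    in which they are performed; units are served in order of arrival, so that
    the unit leaving the hub after hub service [k] is the one that receives
    satellite service [k].  [E k] and [C k] are the completion times of hub
    service [k] and of satellite service [k]. *)

(** Hub service [k] starts as soon as service [k - 1] is over and the unit it
    is given to is present: this unit is there from time 0 if [k < N], and
    otherwise it arrives at the hub at the end of satellite service [k - N]. *)
Definition hub_start (R : realType) (N : nat) (E C : nat -> R) (k : nat) : R :=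
  Num.max (if k is j.+1 then E j else 0) (if (k < N)%N then 0 else C (k - N)%N).

Definition satellite_start (R : realType) (E C : nat -> R) (k : nat) : R :=
  Num.max (E k) (if k is j.+1 then C j else 0).

(** The number [K] of units in the hub immediately before the start of service
    [k]: of the [k] units released by the earlier services, those not yet
    returned are in the satellite station, and all other units are in the hub.
    At a common instant, a unit released by service [k - 1] is counted as gone
    and a unit whose return triggers service [k] as arrived, so that
    [1 <= K <= N] for nonnegative service times. *)
Definition hub_state (R : realType) (N : nat) (E C : nat -> R) (k : nat) : nat :=
  (N - \sum_(j < k) (hub_start N E C k < C j)%R)%N.

(** [Q_N(t)].  For nonnegative service times the set is finite: if [k] is its
    least element then [E (k + N) >= C k > t], so it lies in [k, k + N). *)
Definition satellite_number (R : realType) (E C : nat -> R) (t : R) : nat :=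
  #|` fset_set [set k | E k <= t < C k]|.

Definition satellite_fraction (R : realType) (N : nat) (E C : nat -> R) (t : R)
  : R := (satellite_number E C t)%:R / N%:R.

Definition hub_fraction (R : realType) (N : nat) (E C : nat -> R) (t : R) : R :=
  (N%:R - (satellite_number E C t)%:R) / N%:R.

Section network.
Context d (T : measurableType d) (R : realType) (P : probability T R).

Definition mutually_independent (X : nat -> {RV P >-> R}) : Prop :=
  forall (J : {fset nat}) (B : nat -> set R), (forall j, measurable (B j)) ->
    P (\bigcap_(j in [set` J]) X j @^-1` B j) =
    (\prod_(j <- J) P (X j @^-1` B j))%E.

(** The sigma-algebra generated by the first [k] hub service times [D] and all
    satellite service times [S]; it determines the state of the hub at the
    start of hub service [k]. *)
Definition past (D S : nat -> {RV P >-> R}) (k : nat) : set (set T) :=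
  <<s (\bigcup_(i in `I_k) preimage_set_system [set: T] (D i) measurable) `|`
      (\bigcup_j preimage_set_system [set: T] (S j) measurable) >>.

(** The closed network with [N] units, all in the hub at time 0, hub service
    times [D] and satellite service times [S].  Hub service times do depend on
    satellite service times, through the state of the hub; the last field says
    that they depend on nothing else: given [past D S k], the distribution
    function of [D k] is [x |-> G (K x)], where [K] is the state of the hub at
    the start of service [k]. *)
Record closed_network (G : R -> R) (mu : R) (N : nat)
    (D S : nat -> {RV P >-> R}) (E C : nat -> T -> R) : Prop := {
  hub_completion : forall k w,
    E k w = hub_start N (E ^~ w) (C ^~ w) k + D k w ;
  satellite_completion : forall k w,
    C k w = satellite_start (E ^~ w) (C ^~ w) k + S k w ;
  satellite_exponential : forall k (B : set R), measurable B ->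
    distribution P (S k) B = exponential_prob (mu * N%:R) B ;
  satellite_independent : mutually_independent S ;
  hub_conditional_law : forall k (x : R) (A : set T), past D S k A ->
    P (A `&` [set w | D k w <= x]) =
    (\int[P]_(w in A) (G ((hub_state N (E ^~ w) (C ^~ w) k)%:R * x))%:E)%E
}.

End network.

(* Main.v *)
Require Import Defs.
From HB Require Import structures.
From mathcomp Require Import all_boot all_order all_algebra finmap.
From mathcomp Require Import all_classical all_reals all_analysis.
From mathcomp Require Import measurable_realfun ring lra zify.

Import Order.TTheory GRing.Theory Num.Theory.
Import numFieldNormedType.Exports.
Local Open Scope classical_set_scope.
Local Open Scope ring_scope.

(** The normalized hub services [X k = K * D k] are i.i.d. with law [G], and so
    are the satellite services up to a scaling, but nothing is known about the
    joint law of the networks for different [N].  Almost sure convergence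
    therefore needs summable deviation probabilities, and the finite second
    moment of [G] is just enough for that (Hsu-Robbins): truncating at
    [delta N], the untruncated part costs [N * P (X > delta N)], which is
    summable, and Chernoff's bound makes the rest [O(N^-2)], uniformly for all
    partial sums up to index [L N].

    What remains is deterministic.  For a fixed path whose partial sums of hub
    and satellite services are within [eps] of linear on the scale [N], look at
    the last completion time at which [Q_N <= N q] (up to 1), where [q] is the
    fluid limit: from then on the satellite is busy and [K <= N (1 - q)], so the
    balance equation [q' = lambda (1 - q) - mu] keeps [Q_N / N] below
    [q + O(eps)].  This bound shows that the hub never starves and that its
    services are short, after which the same comparison works from below. *)

(** The comparison is made in units of hub work rather than of time, at hub completions only. Let
    [H] be the integral of [1 - q], so that [q = lambda H - mu t]. Since [q] increases, [H] is
    concave: its increment over one service lies between the length times [1 - q] at the end and the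
    length times [1 - q] at the start. In the upper comparison [K] is controlled through the
    population at the end of the service, in the lower one through the population at its start; each
    is the end that the concavity estimate asks for, so no discretization error accumulates along
    the path. The number of services performed up to a fixed time is random, which is why deviations
    must be controlled for all indices up to [L N] at once: as [K <= N], an [L] slightly above
    [lambda] times the horizon suffices. The hub service times themselves are neither independent
    nor identically distributed. What can be proved is that [K * D k] has law [G] and is independent
    of the past of service [k]; independence is therefore used throughout in the form of a
    filtration. *)

Lemma last_true (Q : nat -> Prop) (k : nat) : Q 0%N ->
  exists2 j, (j <= k)%N /\ Q j & forall i, (j < i <= k)%N -> ~ Q i.
Proof.
move=> Q0; elim: k => [|k [j [jk Qj] jQ]].
  by exists 0%N => // i; lia.
have [Qk|nQk] := pselect (Q k.+1).
  by exists k.+1 => // i; lia.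
exists j; first by split=> //; lia.
move=> i /andP[ji]; rewrite leq_eqVlt => /orP[/eqP->//|ik].
by apply: jQ; lia.
Qed.

Lemma card_fset_set_nat (b : nat -> bool) (n : nat) :
  (forall i, b i -> (i < n)%N) ->
  #|` fset_set [set i | b i]| = (\sum_(i < n) b i)%N.
Proof.
move=> bn.
have -> : fset_set [set i | b i] = [fset x in [seq i <- iota 0 n | b i]]%fset.
  apply/fsetP => i; rewrite in_fset_set; last first.
    by apply: (sub_finite_set _ (finite_II n)) => j /= /bn.
  rewrite !inE/= mem_filter mem_iota add0n/=.
  apply/idP/andP => [|[bi _]]; last by rewrite inE.
  by rewrite inE /= => bi; split=> //; exact: bn.
rewrite card_fseq undup_id ?filter_uniq ?iota_uniq// size_filter.
have -> : iota 0 n = index_iota 0 n by rewrite /index_iota subn0.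
by rewrite -sum1_count big_mkcond/= big_mkord; apply: eq_bigr => i _; case: (b i).
Qed.

(** * The fluid limit and its balance equation *)

Section fluid_limit.
Context {R : realType} (lambda mu : R).

Definition fluid_satellite (t : R) : R :=
  (1 - mu / lambda) * (1 - expR (- (lambda * t))).

Local Notation qf := fluid_satellite.

(* Integral of [1 - fluid_satellite] over [[0, t]], in a closed form that makes
   the balance equation [q = lambda H - mu t] an identity. *)
Definition fluid_hub_work (t : R) : R := (qf t + mu * t) / lambda.

Local Notation Hf := fluid_hub_work.
Hypotheses (mu_gt0 : 0 < mu) (mu_lambda : mu < lambda).

Let lambda_gt0 : 0 < lambda. Proof. exact: lt_trans mu_lambda. Qed.

Lemma fluid_satellite0 : qf 0 = 0.
Proof. by rewrite /qf mulr0 oppr0 expR0 subrr mulr0. Qed.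

Lemma fluid_balance t : lambda * Hf t = qf t + mu * t.
Proof. by rewrite /Hf mulrC divfK// gt_eqF. Qed.

Lemma fluid_ratio_itv : 0 < mu / lambda < 1.
Proof. by rewrite divr_gt0// ltr_pdivrMr// mul1r. Qed.

Lemma fluid_satellite_itv t : 0 <= t -> 0 <= qf t <= 1 - mu / lambda.
Proof.
move=> t0; have /andP[r0 r1] := fluid_ratio_itv.
have e1 : expR (- (lambda * t)) <= 1 by rewrite expR_le1 oppr_le0 mulr_ge0// ltW.
have e0 := expR_ge0 (- (lambda * t)).
have r1' : 0 <= 1 - mu / lambda by rewrite subr_ge0 ltW.
rewrite /qf; apply/andP; split; first by rewrite mulr_ge0// subr_ge0.
by rewrite ler_piMr// gerBl.
Qed.

Lemma fluid_satelliteB a b : qf b - qf a =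
  (1 - mu / lambda) * (expR (- (lambda * a)) - expR (- (lambda * b))).
Proof. by rewrite /qf; ring. Qed.

(** Concavity of [fluid_hub_work], with the slope taken at the left end; the balance equation
    reduces it to [expR x >= 1 + x] at [x = - lambda * (b - a)]. The companion below takes the slope
    at the right end, with the opposite [x]. *)
Lemma fluid_hub_work_le a b : a <= b -> Hf b - Hf a <= (1 - qf a) * (b - a).
Proof.
move=> ab; have /andP[r0 r1] := fluid_ratio_itv.
rewrite -(ler_pM2l lambda_gt0) mulrBr !fluid_balance.
have -> : qf b + mu * b - (qf a + mu * a) = (qf b - qf a) + mu * (b - a) by ring.
rewrite fluid_satelliteB.
have -> : expR (- (lambda * b)) = expR (- (lambda * a)) * expR (- (lambda * (b - a))).
  by rewrite -expRD; congr expR; ring.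
have eb := expR_ge1Dx (- (lambda * (b - a))).
have ea := expR_gt0 (- (lambda * a)).
rewrite /qf; set u := expR (- (lambda * a)) in ea *.
set v := expR _ in eb *.
have -> : lambda * ((1 - (1 - mu / lambda) * (1 - u)) * (b - a)) =
   mu * (b - a) + (1 - mu / lambda) * (u * (lambda * (b - a))).
  by field; rewrite gt_eqF.
rewrite addrC lerD2l ler_wpM2l ?subr_ge0 ?(ltW r1)//.
by rewrite -{1}[u]mulr1 -mulrBr ler_wpM2l ?(ltW ea)//; lra.
Qed.

Lemma fluid_hub_work_ge a b : a <= b -> (1 - qf b) * (b - a) <= Hf b - Hf a.
Proof.
move=> ab; have /andP[r0 r1] := fluid_ratio_itv.
rewrite -(ler_pM2l lambda_gt0) [leRHS]mulrBr !fluid_balance.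
have -> : qf b + mu * b - (qf a + mu * a) = (qf b - qf a) + mu * (b - a) by ring.
rewrite fluid_satelliteB.
have -> : expR (- (lambda * a)) = expR (- (lambda * b)) * expR (lambda * (b - a)).
  by rewrite -expRD; congr expR; ring.
have eb := expR_ge1Dx (lambda * (b - a)).
have ea := expR_gt0 (- (lambda * b)).
rewrite /qf; set u := expR (- (lambda * b)) in ea *.
set v := expR _ in eb *.
have -> : lambda * ((1 - (1 - mu / lambda) * (1 - u)) * (b - a)) =
   mu * (b - a) + (1 - mu / lambda) * (u * (lambda * (b - a))).
  by field; rewrite gt_eqF.
rewrite [leRHS]addrC lerD2l ler_wpM2l ?subr_ge0 ?(ltW r1)//.
by rewrite -{3}[u]mulr1 -mulrBr ler_wpM2l ?(ltW ea)//; lra.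
Qed.

Lemma fluid_satellite_le a b : a <= b -> qf a <= qf b.
Proof.
move=> ab; have /andP[r0 r1] := fluid_ratio_itv.
rewrite -subr_ge0 fluid_satelliteB mulr_ge0 ?subr_ge0 ?(ltW r1)//.
by rewrite ler_expR lerN2 ler_wpM2l// ltW.
Qed.

Lemma fluid_satellite_lipschitz a b : 0 <= a -> a <= b ->
  qf b - qf a <= lambda * (b - a).
Proof.
move=> a0 ab; have := fluid_hub_work_le _ _ ab.
have /andP[qa _] := fluid_satellite_itv _ a0.
rewrite -(ler_pM2l lambda_gt0) mulrBr !fluid_balance => h.
have : lambda * ((1 - qf a) * (b - a)) <= lambda * (b - a).
  by rewrite ler_pM2l// ler_piMl ?subr_ge0// gerBl.
have : 0 <= mu * (b - a) by rewrite mulr_ge0 ?subr_ge0// ltW.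
lra.
Qed.

End fluid_limit.

(** * Sample paths *)

(** Facts about reals are cleared first, so that [lia] deals with indices only. *)
Ltac nat_lia :=
  repeat match goal with
  | H : ?P |- _ =>
    lazymatch P with
    | nat => fail
    | is_true (leq _ _) => fail
    | is_true (leq _ _ && leq _ _) => fail
    | is_true (~~ (@eq_op _ _ _)) => fail
    | @eq nat _ _ => fail
    | _ => clear H
    end
  end; lia.

Lemma telescope_le (R : numDomainType) (f g : nat -> R) j k : (j <= k)%N ->
  (forall i, (j <= i < k)%N -> f i.+1 - f i <= g i.+1 - g i) ->
  f k - f j <= g k - g j.
Proof.
elim: k => [|k IH]; first by rewrite leqn0 => /eqP-> _; rewrite !subrr.
rewrite leq_eqVlt => /orP[/eqP->|]; first by rewrite !subrr.
rewrite ltnS => jk h.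
have h1 : f k - f j <= g k - g j by apply: IH => // i ?; apply: h; nat_lia.
have h2 : f k.+1 - f k <= g k.+1 - g k by apply: h; nat_lia.
have e (u : nat -> R) : u k.+1 - u j = (u k.+1 - u k) + (u k - u j).
  by rewrite addrA subrK.
by rewrite !e lerD.
Qed.

Section sample_path.
Context {R : realType} (N : nat) (E C D S : nat -> R).
Hypothesis N_gt0 : (0 < N)%N.
Hypothesis E_def : forall k, E k = hub_start N E C k + D k.
Hypothesis C_def : forall k, C k = satellite_start E C k + S k.
Hypothesis D_gt0 : forall k, 0 < D k.
Hypothesis S_ge0 : forall k, 0 <= S k.

(** Used in two ways: [unreturned k.+1 (E k)] is the satellite population at the end of hub service
    [k], the unit just released being among the candidates; [unreturned k] at the start of service
    [k] is what [hub_state] subtracts from [N]. *)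
Definition unreturned (k : nat) (t : R) : nat := (\sum_(j < k) (t < C j)%R)%N.

Lemma hub_start0 : hub_start N E C 0 = 0.
Proof. by rewrite /hub_start N_gt0 maxxx. Qed.

Lemma hub_start_ge k : E k <= hub_start N E C k.+1.
Proof. by rewrite /hub_start le_max lexx. Qed.

Lemma hub_completion_ltS k : E k < E k.+1.
Proof.
by rewrite [ltRHS]E_def (le_lt_trans (hub_start_ge k))// ltrDl.
Qed.

Lemma hub_completion_lt i j : (i < j)%N -> E i < E j.
Proof.
elim: j => // j IH; rewrite ltnS leq_eqVlt => /orP[/eqP->|/IH h].
  exact: hub_completion_ltS.
exact: lt_trans h (hub_completion_ltS j).
Qed.

Lemma hub_completion_le i j : (i <= j)%N -> E i <= E j.
Proof. by rewrite leq_eqVlt => /orP[/eqP->//|/hub_completion_lt/ltW]. Qed.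

Lemma hub_completion0 : E 0 = D 0.
Proof. by rewrite E_def hub_start0 add0r. Qed.

Lemma hub_completion_gt0 k : 0 < E k.
Proof.
by rewrite (lt_le_trans _ (hub_completion_le 0 k _))// hub_completion0.
Qed.

Lemma satellite_completionS k : C k + S k.+1 <= C k.+1.
Proof. by rewrite [leRHS]C_def lerD2r /satellite_start le_max lexx orbT. Qed.

Local Notation s k := (\sum_(i < k) S i).

Lemma satellite_completion_lb i j : (i <= j)%N ->
  C i + (s j.+1 - s i.+1) <= C j.
Proof.
elim: j => [|j IH]; first by rewrite leqn0 => /eqP->; rewrite subrr addr0.
rewrite leq_eqVlt => /orP[/eqP->|]; first by rewrite subrr addr0.
rewrite ltnS => /IH h; rewrite big_ord_recr/=.
by apply: le_trans (satellite_completionS j); lra.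
Qed.

Lemma satellite_completion_le i j : (i <= j)%N -> C i <= C j.
Proof.
elim: j => [|j IH]; first by rewrite leqn0 => /eqP->.
rewrite leq_eqVlt => /orP[/eqP->//|]; rewrite ltnS => /IH h.
apply: (le_trans h); apply: le_trans (satellite_completionS j).
by rewrite lerDl.
Qed.

Lemma satellite_completion_busy p l : (p <= l)%N ->
  (forall i, (p < i <= l)%N -> E i <= C i.-1) ->
  C l = C p + (s l.+1 - s p.+1).
Proof.
elim: l => [|l IH]; first by rewrite leqn0 => /eqP-> _; rewrite subrr addr0.
rewrite leq_eqVlt => /orP[/eqP->|]; first by rewrite subrr addr0.
rewrite ltnS => pl h; rewrite C_def /satellite_start.
have /max_idPr -> : E l.+1 <= C l by apply: (h l.+1); nat_lia.
rewrite IH//; last by move=> i ?; apply: h; nat_lia.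
by rewrite [in RHS]big_ord_recr/=; lra.
Qed.

Lemma hub_le_satellite k : E k <= C k.
Proof.
rewrite C_def; apply: (@le_trans _ _ (satellite_start E C k)).
  by rewrite /satellite_start le_max lexx.
by rewrite lerDl.
Qed.

(** Satellite completions are ordered, so the units still out form a final segment [[p, k)], and
    counting them amounts to locating [p]. *)
Lemma unreturnedP k t : exists p, [/\ (p <= k)%N, unreturned k t = (k - p)%N,
  forall j, (j < p)%N -> C j <= t & forall j, (p <= j < k)%N -> t < C j].
Proof.
elim: k => [|k [p [pk up pC Cp]]].
  by exists 0%N; split => //; rewrite /unreturned big_ord0.
have -> : unreturned k.+1 t = (unreturned k t + (t < C k)%R)%N.
  by rewrite /unreturned big_ord_recr.
have [tC|Ct] := ltP t (C k).
  exists p; split=> //; [exact: leqW|by rewrite up/=; nat_lia|].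
  move=> j jk; have [->//|jk'] := eqVneq j k; apply: Cp; nat_lia.
exists k.+1; split => //.
- have [pk'|pk'] := eqVneq p k; first by rewrite up pk' addn0 !subnn.
  have : t < C k.-1 by apply: Cp; nat_lia.
  by rewrite ltNge (le_trans _ Ct)// satellite_completion_le//; nat_lia.
- by move=> j jk; apply: le_trans Ct; apply: satellite_completion_le; nat_lia.
- by move=> j; nat_lia.
Qed.

Lemma unreturned_le k : {homo unreturned k : t u / (t <= u)%R >-> (u <= t)%N}.
Proof.
move=> t u tu; apply: leq_sum => j _.
by have [ut|//] := ltP u (C j); rewrite (le_lt_trans tu ut).
Qed.

(** Service [k] waits for the return [C (k - N)], so at its start at most the units
    [k - N + 1, ..., k - 1] are out. *)
Lemma unreturned_hub_start k : (unreturned k (hub_start N E C k) < N)%N.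
Proof.
have [p [pk -> pC Cp]] := unreturnedP k (hub_start N E C k).
have [kN|Nk] := ltnP k N; first by nat_lia.
rewrite ltnNge; apply/negP => kpN.
have : hub_start N E C k < C (k - N)%N by apply: Cp; nat_lia.
by rewrite ltNge /hub_start ltnNge Nk/= le_max lexx orbT.
Qed.

Lemma hub_stateE k : (hub_state N E C k)%:R =
  N%:R - (unreturned k (hub_start N E C k))%:R :> R.
Proof. by rewrite /hub_state natrB// ltnW// unreturned_hub_start. Qed.

Lemma hub_state_gt0 k : (0 < hub_state N E C k)%N.
Proof. by rewrite subn_gt0 unreturned_hub_start. Qed.

Lemma hub_state_le k : (hub_state N E C k <= N)%N.
Proof. exact: leq_subr. Qed.

Lemma hub_stateE_nonstarving k : (unreturned k.+1 (E k) < N)%N ->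
  hub_start N E C k.+1 = E k.
Proof.
move=> uN; rewrite /hub_start; apply/max_idPl.
case: ltnP => kN; first exact/ltW/hub_completion_gt0.
have [p [pk up pC _]] := unreturnedP k.+1 (E k).
by apply: pC; nat_lia.
Qed.

Lemma satellite_numberE k t : E k <= t < E k.+1 ->
  satellite_number E C t = unreturned k.+1 t.
Proof.
move=> /andP[Ekt tEk].
rewrite /satellite_number (card_fset_set_nat (fun i => E i <= t < C i) k.+1).
  apply: eq_bigr => i _.
  rewrite (le_trans _ Ekt)//; apply: hub_completion_le.
  by rewrite -ltnS.
move=> i /andP[Eit _]; rewrite ltnNge; apply/negP => /hub_completion_le.
by rewrite leNgt (le_lt_trans Eit tEk).
Qed.

Lemma satellite_number_init t : t < E 0%N -> satellite_number E C t = 0%N.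
Proof.
move=> tE; rewrite /satellite_number (card_fset_set_nat _ 0) ?big_ord0// => i.
move=> /andP[+ _]; rewrite leNgt (lt_le_trans tE)//.
exact: hub_completion_le.
Qed.


(** * Comparison of a fixed path with the fluid limit *)

Variables (lambda mu : R) (M : nat) (eps : R).
Hypotheses (mu_gt0 : 0 < mu) (mu_lambda : mu < lambda).
Local Notation qf := (fluid_satellite lambda mu).
Local Notation Hf := (fluid_hub_work lambda mu).

Definition hub_work (k : nat) : R := (hub_state N E C k)%:R * D k.
Local Notation sigma k := (\sum_(i < k) hub_work i).
Local Notation Q k := (unreturned k.+1 (E k)).

Hypothesis hub_work_lln :
  forall k, (k <= M)%N -> `|sigma k - k%:R / lambda| <= eps * N%:R.
Hypothesis satellite_work_lln :
  forall k, (k <= M)%N -> `|s k - k%:R / (mu * N%:R)| <= eps.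
Hypothesis eps_N : 1 <= eps * N%:R.

Let lambda_gt0 : 0 < lambda. Proof. exact: lt_trans mu_lambda. Qed.
Let N_gt0R : 0 < N%:R :> R. Proof. by rewrite ltr0n. Qed.
Let muN_gt0 : 0 < mu * N%:R. Proof. exact: mulr_gt0. Qed.
Let eps_gt0 : 0 < eps.
Proof. by rewrite -(pmulr_lgt0 _ N_gt0R) (lt_le_trans _ eps_N). Qed.

Lemma hub_work_increment j k : (j <= M)%N -> (k <= M)%N ->
  `|lambda * (sigma k - sigma j) - (k%:R - j%:R)| <= 2 * lambda * eps * N%:R.
Proof.
move=> /hub_work_lln hj /hub_work_lln hk.
have -> : lambda * (sigma k - sigma j) - (k%:R - j%:R) =
  lambda * ((sigma k - k%:R / lambda) - (sigma j - j%:R / lambda)).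
  by field; rewrite gt_eqF.
rewrite normrM gtr0_norm//.
have -> : 2 * lambda * eps * N%:R = lambda * (eps * N%:R + eps * N%:R) by ring.
by rewrite ler_pM2l// (le_trans (ler_normB _ _))// lerD.
Qed.

Lemma satellite_work_increment j k : (j <= M)%N -> (k <= M)%N ->
  `|mu * N%:R * (s k - s j) - (k%:R - j%:R)| <= 2 * mu * eps * N%:R.
Proof.
move=> /satellite_work_lln hj /satellite_work_lln hk.
have -> : mu * N%:R * (s k - s j) - (k%:R - j%:R) =
  mu * N%:R * ((s k - k%:R / (mu * N%:R)) - (s j - j%:R / (mu * N%:R))).
  by field; rewrite !gt_eqF.
rewrite normrM gtr0_norm//.
have -> : 2 * mu * eps * N%:R = mu * N%:R * (eps + eps) by ring.
by rewrite ler_pM2l// (le_trans (ler_normB _ _))// lerD.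
Qed.

(** Idling only delays returns, so if the satellite services [p, ..., l - 1] all end in [(t, u]],
    the work of all but the first of them fits into this interval. The first may be in progress at
    [t], which costs the final 1. *)
Lemma returns_ub p l t u : t <= u -> (l <= M)%N ->
  ((p < l)%N -> t < C p) -> ((p < l)%N -> C l.-1 <= u) ->
  l%:R - p%:R <= mu * N%:R * (u - t) + 2 * mu * eps * N%:R + 1.
Proof.
move=> tu lM tC Cu; have [lp|pl] := leqP l p.
  have h : l%:R <= p%:R :> R by rewrite ler_nat.
  have h1 : 0 <= mu * N%:R * (u - t) by rewrite mulr_ge0 ?subr_ge0// ltW.
  have h2 : 0 <= 2 * mu * eps * N%:R by rewrite !mulr_ge0// ltW.
  lra.
have hC := @satellite_completion_lb p l.-1 ltac:(nat_lia).
rewrite prednK in hC; last by nat_lia.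
have hs : s l - s p.+1 <= u - t by have := tC pl; have := Cu pl; lra.
have := satellite_work_increment p.+1 l ltac:(nat_lia) lM.
rewrite ler_norml => /andP[h1 _].
have h2 : mu * N%:R * (s l - s p.+1) <= mu * N%:R * (u - t) by rewrite ler_pM2l.
have : p.+1%:R = p%:R + 1 :> R by rewrite -natr1.
lra.
Qed.

(** Balance of units: those out at [t], plus the releases [j, ..., k - 1], minus the returns up to
    [u]. The hypothesis on [C] says that none of these releases has returned by [t]. *)
Lemma unreturned_lb j k t u : (j <= k)%N -> t <= u -> (k <= M)%N ->
  (forall i, (j <= i < k)%N -> t < C i) ->
  (unreturned j t)%:R + (k%:R - j%:R) -
    (mu * N%:R * (u - t) + 2 * mu * eps * N%:R + 1) <= (unreturned k u)%:R.
Proof.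
move=> jk tu kM tC.
have [p [pj -> pC Cp]] := unreturnedP j t.
have [l [lk -> lC Cl]] := unreturnedP k u.
rewrite !natrB//.
have := returns_ub p l t u tu ltac:(nat_lia).
have h1 : (p < l)%N -> t < C p.
  move=> pl; have [pj'|pj'] := ltnP p j; first by apply: Cp; nat_lia.
  by apply: tC; nat_lia.
have h2 : (p < l)%N -> C l.-1 <= u by move=> pl; apply: lC; nat_lia.
move=> /(_ h1 h2); lra.
Qed.

(** With two units out at [E i], unit [i - 1] is one of them, so the satellite passes to unit [i]
    without idling. *)
Lemma unreturned_ge2 i : (1 < Q i)%N -> E i <= C i.-1.
Proof.
have [p [pi -> pC Cp]] := unreturnedP i.+1 (E i) => h.
by apply/ltW/Cp; nat_lia.
Qed.

(** A busy satellite returns units at full speed. Service [p], the first not over at [E j], has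
    begun by [E j], and service [l], the first not over at [E k], ends after [E k]; the services
    [p, ..., l] follow each other without a gap, so [s l.+1 - s p] exceeds [E k - E j]. *)
Lemma unreturned_ub_busy j k : (j < k < M)%N ->
  (forall i, (j < i <= k)%N -> (1 < Q i)%N) ->
  (Q k)%:R - (Q j)%:R <= k%:R - j%:R - mu * N%:R * (E k - E j) +
    2 * mu * eps * N%:R + 1 :> R.
Proof.
move=> /andP[jk kM] Q2.
have [p [pj Qj pC Cp]] := unreturnedP j.+1 (E j).
have [l [lk Qk lC Cl]] := unreturnedP k.+1 (E k).
have EjC : E j < C j.
  have := unreturned_ge2 j.+1 (Q2 j.+1 ltac:(nat_lia)); rewrite /=.
  by apply: lt_le_trans; exact: hub_completion_ltS.
have pj' : (p <= j)%N.
  by rewrite leqNgt; apply/negP => jp; have := pC j jp; rewrite leNgt EjC.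
have EjCp : E j < C p by apply: Cp; nat_lia.
have Qk2 := Q2 k ltac:(nat_lia).
have lk' : (l < k)%N by nat_lia.
have EkCl : E k < C l by apply: Cl; nat_lia.
have pl : (p <= l)%N.
  rewrite leqNgt; apply/negP => lp; have := pC l lp; rewrite leNgt.
  by rewrite (lt_trans _ EkCl)//; exact: hub_completion_lt.
have busy : C l = C p + (s l.+1 - s p.+1).
  apply: satellite_completion_busy => // i /andP[pi il].
  have [ij|ji] := leqP i j; last by apply: unreturned_ge2; apply: Q2; nat_lia.
  rewrite (le_trans (hub_completion_le _ _ ij))// (le_trans (ltW EjCp))//.
  by apply: satellite_completion_le; nat_lia.
have Cpub : C p <= E j + S p.
  rewrite C_def lerD2r /satellite_start ge_max hub_completion_le//=.
  by case: p pC {pj Qj Cp pj' EjCp pl busy} => [_|p ->//]; exact/ltW/hub_completion_gt0.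
have := satellite_work_increment p l.+1 ltac:(nat_lia) ltac:(nat_lia).
rewrite ler_norml => /andP[_ h1].
have h2 : mu * N%:R * (E k - E j) <= mu * N%:R * (s l.+1 - s p).
  rewrite ler_pM2l//; move: busy Cpub EkCl; rewrite [s p.+1]big_ord_recr/=; lra.
rewrite Qj Qk !natrB// -!natr1.
by move: h1 h2; rewrite -!natr1; lra.
Qed.

(** During service [i] the satellite population only decreases, except for unit [i], which joins it
    at the end. This bounds the state at the start through the population at the end, up to one
    unit. *)
Lemma unreturned_start i : (Q i <= (unreturned i (hub_start N E C i)).+1)%N.
Proof.
rewrite {1}/unreturned big_ord_recr/= -/(unreturned i (E i)).
apply: (@leq_trans (unreturned i (E i)).+1).
  by rewrite -addn1 leq_add2l leq_b1.
by rewrite ltnS; apply: unreturned_le; rewrite [leRHS]E_def lerDl ltW.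
Qed.

Lemma hub_state_ub i : (hub_state N E C i)%:R <= N%:R + 1 - (Q i)%:R :> R.
Proof.
have := unreturned_start i; rewrite -(ler_nat R) -natr1 hub_stateE; lra.
Qed.

Lemma hub_service_le i : D i.+1 <= E i.+1 - E i.
Proof. by rewrite E_def; have := hub_start_ge i; lra. Qed.

Lemma satellite_upper k : (k < M)%N ->
  (Q k)%:R <= N%:R * (qf (E k) + (2 * lambda + 2 * mu + 2) * eps).
Proof.
move=> kM.
(* The slack 1 pays for the unit lost in [hub_state_ub], and it makes [Q i > 1] at a bad index, so
   that the satellite is busy there. *)
pose good i := (Q i)%:R <= N%:R * qf (E i) + 1.
have good0 : good 0%N.
  rewrite /good /unreturned big_ord_recl big_ord0 addn0.
  have /andP[q0 _] := fluid_satellite_itv _ _ mu_gt0 mu_lambda (E 0%N) (ltW (hub_completion_gt0 0)).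
  apply: (@le_trans _ _ 1); first by rewrite lern1 leq_b1.
  by rewrite lerDr mulr_ge0.
have [j [jk gj] jgood] := last_true good k good0.
have E0 i : 0 <= E i by exact/ltW/hub_completion_gt0.
have eN : 0 < eps * N%:R by exact: mulr_gt0.
have leN : 0 < lambda * (eps * N%:R) by exact: mulr_gt0.
have meN : 0 < mu * (eps * N%:R) by exact: mulr_gt0.
have [kj|kj] := eqVneq j k.
  by move: gj; rewrite /good kj; move: eps_N leN meN; nra.
have {jgood}bad i : (j < i <= k)%N -> N%:R * qf (E i) + 1 < (Q i)%:R.
  by move=> /jgood; rewrite /good => /negP; rewrite -ltNge.
have Q2 i : (j < i <= k)%N -> (1 < Q i)%N.
  move=> /bad h; rewrite -(ltr_nat R) (le_lt_trans _ h)// lerDr mulr_ge0//.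
  by have /andP[] := fluid_satellite_itv _ _ mu_gt0 mu_lambda (E i) (E0 i).
have hQ := unreturned_ub_busy j k ltac:(nat_lia) Q2.
(* Service by service: [K <= N (1 - q)] with [q] at the end of the service, and concavity of [Hf]
   with the slope at that same end. *)
have hX : sigma k.+1 - sigma j.+1 <= N%:R * Hf (E k) - N%:R * Hf (E j).
  apply: (telescope_le _ (fun k => sigma k.+1) (fun k => N%:R * Hf (E k))) => // i ji.
  rewrite big_ord_recr/= addrAC subrr add0r -mulrBr.
  have bi := bad i.+1 ltac:(nat_lia).
  apply: (@le_trans _ _ (N%:R * ((1 - qf (E i.+1)) * (E i.+1 - E i)))); last first.
    by rewrite ler_pM2l// fluid_hub_work_ge// hub_completion_le.
  have /andP[q0 q1] := fluid_satellite_itv _ _ mu_gt0 mu_lambda (E i.+1) (E0 i.+1).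
  have /andP[r0 r1] := fluid_ratio_itv _ _ mu_gt0 mu_lambda.
  rewrite /hub_work mulrA ler_pM// ?hub_service_le//; last first.
    have := hub_state_ub i.+1; lra.
  exact/ltW.
have := hub_work_increment j.+1 k.+1 ltac:(nat_lia) ltac:(nat_lia).
rewrite ler_norml => /andP[h1 _].
have h2 : lambda * (sigma k.+1 - sigma j.+1) <=
  N%:R * (qf (E k) - qf (E j)) + mu * N%:R * (E k - E j).
  apply: le_trans (_ : lambda * (N%:R * Hf (E k) - N%:R * Hf (E j)) <= _).
    by rewrite ler_pM2l.
  have := fluid_balance _ _ mu_gt0 mu_lambda (E k).
  have := fluid_balance _ _ mu_gt0 mu_lambda (E j).
  move=> bj bk.
  have -> : lambda * (N%:R * Hf (E k) - N%:R * Hf (E j)) =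
    N%:R * (lambda * Hf (E k) - lambda * Hf (E j)) by ring.
  by rewrite bj bk; lra.
(* The terms [2 lambda eps N] and [2 mu eps N] come from the two laws of large numbers; two single
   units, one from [good] and one from the balance, are absorbed by [2 eps N]. *)
move: gj h1 h2 hQ eps_N; rewrite /good -!natr1; lra.
Qed.

Hypothesis eps_small : (2 * lambda + 2 * mu + 2) * eps <= mu / (2 * lambda).
(** [c2 * eps] will bound every hub service: one service adds at most [1 + 2 lambda eps N <= (1 + 2
    lambda) eps N] to [lambda] times the work, while [K >= N mu / (2 lambda)]. *)
Let c2 := 2 * (1 + 2 * lambda) / mu.

Let c2_gt0 : 0 < c2.
Proof. by rewrite divr_gt0// mulr_gt0// addr_gt0// mulr_gt0. Qed.

(** The limit stays below [1 - mu / lambda], and [eps_small] confines the error of the upper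
    comparison to half of the gap [mu / lambda]. *)
Lemma unreturned_ub k : (k < M)%N ->
  (Q k)%:R <= N%:R * (1 - mu / (2 * lambda)).
Proof.
move=> kM; apply: le_trans (satellite_upper k kM) _; rewrite ler_pM2l//.
have /andP[q0 q1] := fluid_satellite_itv _ _ mu_gt0 mu_lambda (E k)
  (ltW (hub_completion_gt0 k)).
have : mu / lambda = mu / (2 * lambda) + mu / (2 * lambda).
  by field; rewrite gt_eqF.
move: eps_small; lra.
Qed.

Lemma hub_start_nonstarving k : (k < M)%N -> hub_start N E C k.+1 = E k.
Proof.
move=> kM; apply: hub_stateE_nonstarving; rewrite -(ltr_nat R).
apply: le_lt_trans (unreturned_ub k kM) _.
by rewrite gtr_pMr// gtrBl divr_gt0// mulr_gt0.
Qed.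

Lemma hub_state_lb k : (k < M)%N ->
  N%:R * (mu / (2 * lambda)) <= (hub_state N E C k)%:R.
Proof.
have h : mu / (2 * lambda) <= 1.
  by rewrite ler_pdivrMr ?mulr_gt0// mul1r; move: mu_lambda mu_gt0; lra.
case: k => [_|k kM].
  rewrite hub_stateE hub_start0 /unreturned big_ord0 subr0.
  by rewrite ler_piMr.
rewrite hub_stateE hub_start_nonstarving; last by nat_lia.
by have := unreturned_ub k ltac:(nat_lia); lra.
Qed.

Lemma hub_service_short k : (k < M)%N -> D k <= c2 * eps.
Proof.
move=> kM; have := hub_work_increment k k.+1 ltac:(nat_lia) kM.
rewrite ler_norml big_ord_recr/= -natr1 => /andP[_ h1].
have h2 : lambda * (N%:R * (mu / (2 * lambda)) * D k) <= lambda * hub_work k.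
  by rewrite ler_pM2l// ler_wpM2r ?hub_state_lb// ltW.
have -> : c2 * eps = 2 * (1 + 2 * lambda) * (eps * N%:R) / (mu * N%:R).
  by rewrite /c2; field; rewrite !gt_eqF.
rewrite ler_pdivlMr//.
have e2 : lambda * (N%:R * (mu / (2 * lambda)) * D k) = D k * (mu * N%:R) / 2.
  by field; rewrite gt_eqF.
rewrite e2 in h2; move: eps_N; lra.
Qed.

Lemma satellite_lower k : (k < M)%N ->
  N%:R * (qf (E k) - (2 * lambda * c2 + 2 * lambda + 2 * mu) * eps) <= (Q k)%:R.
Proof.
move=> kM.
have E0 i : 0 <= E i by exact/ltW/hub_completion_gt0.
have qE i := fluid_satellite_itv _ _ mu_gt0 mu_lambda (E i) (E0 i).
pose good i := i = 0%N \/ N%:R * qf (E i) <= (Q i)%:R.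
have [j [jk gj] jgood] := last_true good k (or_introl erefl).
have lce : 0 < lambda * c2 * eps by apply: mulr_gt0 => //; exact: mulr_gt0.
have {}gj : N%:R * (qf (E j) - lambda * c2 * eps) <= (Q j)%:R.
  case: gj => [->|gj]; last first.
    by apply: le_trans gj; rewrite ler_pM2l// gerBl ltW.
  apply: (@le_trans _ R 0) => //; rewrite pmulr_rle0// subr_le0.
  have := fluid_satellite_lipschitz _ _ mu_gt0 mu_lambda 0 (E 0%N) (lexx _) (E0 0%N).
  rewrite fluid_satellite0 !subr0 => /le_trans; apply.
  rewrite -mulrA ler_pM2l// hub_completion0.
  by apply: hub_service_short; nat_lia.
have le_err : 0 <= lambda * c2 * eps * N%:R by apply/ltW/mulr_gt0.
have lN : 0 <= lambda * eps * N%:R by rewrite !mulr_ge0// ltW.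
have mN : 0 <= mu * eps * N%:R by rewrite !mulr_ge0// ltW.
have [kj|kj] := eqVneq j k; first by rewrite -kj; lra.
have {jgood}bad i : (j < i <= k)%N -> (Q i)%:R < N%:R * qf (E i).
  by move=> /jgood ni; rewrite ltNge; apply/negP => h; apply: ni; right.
have hQ := unreturned_lb j.+1 k.+1 (E j) (E k) ltac:(nat_lia)
  (hub_completion_le _ _ jk) ltac:(nat_lia).
have {}hQ := hQ (fun i ji => lt_le_trans
  (hub_completion_lt _ _ (andP ji).1) (hub_le_satellite i)).
(* The sum begins with service [j + 2]. Service [j + 1] starts at the good index [j], where [K] has
   no lower bound of this kind; it is handled by the shortness of hub services. *)
have hX : N%:R * Hf (E k) - N%:R * Hf (E j.+1) <= sigma k.+1 - sigma j.+2.
  apply: (telescope_le _ (fun k => N%:R * Hf (E k)) (fun k => sigma k.+1)); first nat_lia.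
  move=> i ji; rewrite [X in _ <= X - _]big_ord_recr/= addrAC subrr add0r -mulrBr.
  have bi := bad i ltac:(nat_lia).
  have Ei := hub_completion_ltS i.
  apply: (@le_trans _ _ (N%:R * ((1 - qf (E i)) * (E i.+1 - E i)))).
    by rewrite ler_pM2l// fluid_hub_work_le// ltW.
  rewrite mulrA /hub_work hub_stateE hub_start_nonstarving; last by nat_lia.
  have -> : D i.+1 = E i.+1 - E i.
    have := E_def i.+1; rewrite hub_start_nonstarving; last by nat_lia.
    by move=> ->; rewrite addrAC subrr add0r.
  by rewrite ler_wpM2r ?subr_ge0 ?(ltW Ei)//; lra.
have := hub_work_increment j.+2 k.+1 ltac:(nat_lia) ltac:(nat_lia).
rewrite ler_norml => /andP[_ h1].
have Ej := hub_completion_ltS j.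
have DE : E j.+1 - E j <= c2 * eps.
  have := E_def j.+1; rewrite hub_start_nonstarving; last by nat_lia.
  move=> ->; rewrite addrAC subrr add0r; apply: hub_service_short; nat_lia.
have hj : lambda * (Hf (E j.+1) - Hf (E j)) <= lambda * c2 * eps.
  rewrite -mulrA ler_pM2l//; apply: le_trans DE.
  apply: (le_trans (fluid_hub_work_le _ _ mu_gt0 mu_lambda _ _ (ltW Ej))).
  have /andP[q0 _] := qE j.
  by rewrite ler_piMl ?subr_ge0 ?(ltW Ej)// gerBl.
have hj' : N%:R * (lambda * (Hf (E j.+1) - Hf (E j))) <= N%:R * (lambda * c2 * eps).
  by rewrite ler_pM2l.
have h2 : lambda * (N%:R * Hf (E k) - N%:R * Hf (E j.+1)) <=
  lambda * (sigma k.+1 - sigma j.+2) by rewrite ler_pM2l.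
have bk : N%:R * (lambda * Hf (E k)) = N%:R * (qf (E k) + mu * E k).
  by rewrite fluid_balance.
have bj : N%:R * (lambda * Hf (E j)) = N%:R * (qf (E j) + mu * E j).
  by rewrite fluid_balance.
(* The release by service [j + 1], left out of the work, compensates the single unit lost in
   [unreturned_lb]. *)
move: gj h1 h2 hj' hQ bk bj; rewrite -!natr1; lra.
Qed.

Lemma hub_completion_lb k : sigma k.+1 <= N%:R * E k.
Proof.
elim: k => [|k IH].
  rewrite big_ord_recl big_ord0 addr0 /hub_work hub_stateE hub_start0.
  by rewrite /unreturned big_ord0 subr0 hub_completion0.
rewrite big_ord_recr/=; apply: (@le_trans _ _ (N%:R * E k + N%:R * D k.+1)).
  by rewrite lerD// ler_pM2r// ler_nat hub_state_le.
by rewrite -mulrDr ler_pM2l//; have := hub_service_le k; lra.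
Qed.

(** The two groups in parentheses are the errors of the upper and of the lower comparison. The rest
    is for instants between two hub completions: [lambda * c2] for the change of the limit,
    [mu * c2 + 2 * mu + 1] for the returns. *)
Definition fluid_error : R :=
  (2 * lambda + 2 * mu + 2) + (2 * lambda * c2 + 2 * lambda + 2 * mu) +
  lambda * c2 + mu * c2 + 2 * mu + 1.

Lemma satellite_fraction_fluid (T t : R) :
  lambda * N%:R * (T + eps) < M%:R -> 0 <= t <= T ->
  `|satellite_fraction N E C t - qf t| <= fluid_error * eps.
Proof.
move=> TM /andP[t0 tT].
have M0 : (0 < M)%N.
  rewrite -(ltr_nat R); apply: le_lt_trans TM.
  by rewrite !mulr_ge0 ?addr_ge0// ?(ltW eps_gt0) ?(ltW lambda_gt0)// (le_trans t0).
have lc2 : 0 < lambda * c2 by exact: mulr_gt0.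
have mc2 : 0 < mu * c2 by exact: mulr_gt0.
have E0 i : 0 <= E i by exact/ltW/hub_completion_gt0.
(* Since [K <= N], the first [M] services cannot all be over by [T] when
   [M > lambda N (T + eps)]. *)
have EM : T < E M.-1.
  have := hub_work_increment 0 M (leq0n _) (leqnn _).
  have := hub_completion_lb M.-1; rewrite prednK// big_ord0 => h.
  have := hub_work_lln M (leqnn _); rewrite ler_norml => /andP[h1 _] _.
  have h2 : M%:R / lambda - eps * N%:R <= N%:R * E M.-1 by lra.
  have h3 : N%:R * (T + eps) < M%:R / lambda.
    by rewrite ltr_pdivlMr// mulrC mulrA.
  by rewrite -(ltr_pM2l N_gt0R); lra.
have [tE|Et] := ltP t (E 0%N).
  rewrite /satellite_fraction satellite_number_init// mul0r sub0r normrN.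
  have /andP[q0 q1] := fluid_satellite_itv _ _ mu_gt0 mu_lambda t t0.
  rewrite ger0_norm//.
  have := fluid_satellite_lipschitz _ _ mu_gt0 mu_lambda 0 t (lexx _) t0.
  rewrite fluid_satellite0 !subr0 => /le_trans; apply.
  apply: (@le_trans _ _ (lambda * (c2 * eps))).
    rewrite ler_pM2l// (le_trans (ltW tE))// hub_completion0.
    exact: hub_service_short.
  rewrite mulrA ler_pM2r// /fluid_error.
  by move: lc2 mc2 lambda_gt0 mu_gt0; lra.
have [j [jM Ej] jE] := last_true (fun i => E i <= t) M.-1 Et.
have {}jM : (j.+1 < M)%N.
  suff : j != M.-1 by nat_lia.
  by apply/eqP => h; move: Ej; rewrite h leNgt (le_lt_trans tT EM).
have tE : t < E j.+1 by rewrite ltNge; apply/negP; apply: jE; nat_lia.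
rewrite /satellite_fraction (satellite_numberE j) ?Ej//.
have up : (unreturned j.+1 t)%:R <= (Q j)%:R :> R.
  by rewrite ler_nat unreturned_le.
have low := unreturned_lb j.+1 j.+1 (E j) t (leqnn _) Ej ltac:(nat_lia).
have {}low := low (fun i ji => lt_le_trans
  (hub_completion_lt _ _ (andP ji).1) (hub_le_satellite i)).
have uQ := satellite_upper j ltac:(nat_lia).
have lQ := satellite_lower j ltac:(nat_lia).
have q1 := fluid_satellite_le _ _ mu_gt0 mu_lambda _ _ Ej.
have q2 := fluid_satellite_lipschitz _ _ mu_gt0 mu_lambda _ _ (E0 j) Ej.
have tEj : t - E j <= c2 * eps.
  have := hub_service_short j.+1 jM; apply: le_trans.
  have := E_def j.+1; rewrite hub_start_nonstarving; last by nat_lia.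
  by move: tE; lra.
have q3 : lambda * (t - E j) <= lambda * (c2 * eps) by rewrite ler_pM2l.
have m3 : mu * N%:R * (t - E j) <= mu * N%:R * (c2 * eps) by rewrite ler_pM2l.
have -> : (unreturned j.+1 t)%:R / N%:R - qf t =
  ((unreturned j.+1 t)%:R - N%:R * qf t) / N%:R by field; rewrite gt_eqF.
rewrite normrM [X in _ * X]gtr0_norm ?invr_gt0// ler_pdivrMr//.
have Nq1 : N%:R * qf (E j) <= N%:R * qf t by rewrite ler_pM2l.
have Nq2 : N%:R * (qf t - qf (E j)) <= N%:R * (lambda * (c2 * eps)).
  by rewrite ler_pM2l// (le_trans q2).
have eN : 0 < eps * N%:R by exact: mulr_gt0.
have a1 : 0 < lambda * c2 * (eps * N%:R) by exact: mulr_gt0.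
have a2 : 0 < mu * c2 * (eps * N%:R) by exact: mulr_gt0.
have a3 : 0 < lambda * (eps * N%:R) by exact: mulr_gt0.
have a4 : 0 < mu * (eps * N%:R) by exact: mulr_gt0.
rewrite ler_norml /fluid_error; apply/andP; split.
  move: low lQ Nq2 m3 eps_N a1 a2 a3 a4; lra.
move: up uQ Nq1 a1 a2 a3 a4 eN; lra.
Qed.

End sample_path.
Set Implicit Arguments.
Unset Strict Implicit.

(** * Complete convergence *)

(** After multiplication by [expR (- y)] this is [1 - y <= expR (- y)], because
    [(1 + y) (1 - y) + y ^+ 2 = 1]. *)
Lemma expR_le_quadratic {R : realType} (y : R) : 0 <= y ->
  expR y <= 1 + y + y ^+ 2 * expR y.
Proof.
move=> y0.
have e0 := expR_gt0 y.
have h := expR_ge1Dx (- y).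
rewrite -(ler_pM2r (expR_gt0 (- y))) mulrDl -mulrA -expRD subrr expR0 mulr1.
apply: (@le_trans _ _ ((1 + y) * (1 - y) + y ^+ 2)); first by lra.
by rewrite lerD2r ler_wpM2l// addr_ge0.
Qed.

Lemma expRN_le_quadratic {R : realType} (y : R) : 0 <= y ->
  expR (- y) <= 1 - y + y ^+ 2.
Proof.
move=> y0; have h := expR_ge1Dx y; have y1 : 0 < 1 + y by rewrite ltr_pwDl.
rewrite expRN; apply: (@le_trans _ _ (1 + y)^-1).
  by rewrite lef_pV2// posrE ?expR_gt0.
rewrite -(ler_pM2l y1) mulfV ?gt_eqF//.
have -> : (1 + y) * (1 - y + y ^+ 2) = 1 + y ^+ 3 by ring.
by rewrite lerDl exprn_ge0.
Qed.

(** The joint law of [(Z, Y)] agrees with the product law on rectangles, hence everywhere; Tonelli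
    then factors the integral. *)
Lemma integral_mul_indep d d1 d2 (T : measurableType d) (T1 : measurableType d1)
    (T2 : measurableType d2) (R : realType) (P : probability T R)
    (nu : probability T2 R) (Z : T -> T1) (Y : T -> T2) (h : T1 -> R) (f : T2 -> R) :
  measurable_fun [set: T] Z -> measurable_fun [set: T] Y ->
  measurable_fun [set: T1] h -> measurable_fun [set: T2] f ->
  (forall z, 0 <= h z) -> (forall y, 0 <= f y) ->
  (forall A B, measurable A -> measurable B ->
    P (Z @^-1` A `&` Y @^-1` B) = (P (Z @^-1` A) * nu B)%E) ->
  (\int[P]_w (h (Z w) * f (Y w))%:E =
   (\int[P]_w (h (Z w))%:E) * (\int[nu]_y (f y)%:E))%E.
Proof.
move=> mZ mY mh mf h0 f0 ind.
pose ZR : {RV P >-> T1} := mfun_Sub (mem_set mZ : Z \in mfun).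
have mW : measurable_fun [set: T] (fun w => (Z w, Y w)) by exact: measurable_fun_pair.
pose WR : {RV P >-> (T1 * T2)%type} := mfun_Sub (mem_set mW : _ \in mfun).
pose g (p : T1 * T2) : \bar R := (h p.1 * f p.2)%:E.
have mg : measurable_fun setT g.
  by apply/measurable_EFinP; apply: measurable_funM; exact: measurableT_comp.
have g0 p : (0 <= g p)%E by rewrite lee_fin mulr_ge0.
transitivity (\int[distribution P WR]_p g p)%E.
  by rewrite ge0_integral_distribution.
transitivity (\int[distribution P ZR \x nu]_p g p)%E.
  apply: eq_measure_integral => A mA _.
  by apply/esym; apply: (product_measure_unique (m1 := distribution P ZR)).
rewrite fubini_tonelli1//.
transitivity (\int[distribution P ZR]_x ((h x)%:E * \int[nu]_y (f y)%:E))%E.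
  apply: eq_integral => x _; rewrite /fubini_F /g/=.
  under eq_integral do rewrite EFinM.
  rewrite ge0_integralZl_EFin//; first by move=> y _; rewrite lee_fin.
  exact/measurable_EFinP.
rewrite ge0_integralZr//.
- congr (_ * _)%E; rewrite ge0_integral_distribution//.
  exact/measurable_EFinP.
- exact/measurable_EFinP.
- by move=> x _; rewrite lee_fin.
- by apply: integral_ge0 => y _; rewrite lee_fin.
Qed.

(** * Products over i.i.d. sequences and Markov's inequality *)

Section independence.
Context d (T : measurableType d) (R : realType) (P : probability T R).
Variable nu : probability (measurableTypeR R) R.

(* [X] is a sequence of independent variables with law [nu], in the form of a
   filtration: [<<s G k>>] contains the information in [X i] for [i < k], and
   [X k] is independent of it. *)
Record iid_filtration (G : nat -> set (set T)) (X : nat -> T -> R) : Prop := {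
  iid_measurable : forall k, measurable_fun [set: T] (X k) ;
  iid_adapted : forall i k (B : set R), (i < k)%N -> measurable B ->
    <<s G k >> (X i @^-1` B) ;
  iid_indep : forall k (A : set T) (B : set R), <<s G k >> A -> measurable B ->
    P (A `&` X k @^-1` B) = (P A * nu B)%E }.

Section iid.
Variables (G : nat -> set (set T)) (X : nat -> T -> R).
Hypothesis iidX : iid_filtration G X.
Let mX := iid_measurable iidX.

Lemma integral_prod_iid (f : R -> R) k : measurable_fun [set: R] f ->
  (forall y, 0 <= f y) ->
  (\int[P]_w (\prod_(i < k) f (X i w))%:E = (\int[nu]_y (f y)%:E) ^+ k)%E.
Proof.
move=> mf f0; elim: k => [|k IH].
  under eq_integral do rewrite big_ord0.
  rewrite integral_cst//. by rewrite [X in (_ * X)%E]probability_setT mule1 expe0.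
under eq_integral do rewrite big_ord_recr/=.
have p0 w : 0 <= \prod_(i < k) f (X i w) by exact: prodr_ge0.
(* [integral_mul_indep] asks for a function that is nonnegative on all of [R]; on the products the
   absolute value is the identity. *)
under eq_integral do rewrite -(ger0_norm (p0 _)).
rewrite (@integral_mul_indep _ _ _ _ _ _ _ P nu
  (fun w => \prod_(i < k) f (X i w)) (X k) (fun z : R => `|z|) f)//.
- under eq_integral do rewrite ger0_norm//.
  by rewrite IH expeS muleC.
- by apply: measurable_prod => i _; apply: measurableT_comp => //; exact: mX.
- exact: mX.
move=> A B mA mB; apply: (iid_indep iidX) => //.
have : measurable_fun [set: g_sigma_algebraType (G k)]
    (fun w => \prod_(i < k) f (X i w)).
  apply: measurable_prod => i _; apply: measurableT_comp => //.
  move=> _ C mC; rewrite setTI.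
  exact: (iid_adapted iidX).
by move=> /(_ measurableT A mA); rewrite setTI.
Qed.

Lemma markov_prod_iid (f : R -> R) k (a rho : R) : measurable_fun [set: R] f ->
  (forall y, 0 <= f y) -> 0 < a -> 0 <= rho -> (\int[nu]_y (f y)%:E <= rho%:E)%E ->
  (P [set w | a <= \prod_(i < k) f (X i w)]%R <= (a^-1 * rho ^+ k)%:E)%E.
Proof.
move=> mf f0 a0 rho0 frho.
have mp : measurable_fun [set: T] (fun w => \prod_(i < k) f (X i w)).
  by apply: measurable_prod => i _; apply: measurableT_comp => //; exact: mX.
pose U := [set w | a <= \prod_(i < k) f (X i w)]%R.
have mU : measurable U.
  rewrite -[U]setTI (_ : U = (fun w => \prod_(i < k) f (X i w)) @^-1` `[a, +oo[).
    exact: mp.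
  by apply/seteqP; split => w /=; rewrite in_itv/= andbT.
have h : (a%:E * P U <= (rho ^+ k)%:E)%E.
  apply: (@le_trans _ _ (\int[P]_w (\prod_(i < k) f (X i w))%:E)%E).
    rewrite -(setIT U) -integral_indic// -ge0_integralZl_EFin//; last 2 first.
      by apply/measurable_EFinP; exact: measurable_indic.
      exact: ltW.
    apply: ge0_le_integral => //.
    - by move=> w _; rewrite mule_ge0// lee_fin// ltW.
    - apply: measurable_funeM; apply/measurable_EFinP; exact: measurable_indic.
    - exact/measurable_EFinP.
    move=> w _; rewrite indicE -EFinM lee_fin.
    have [/set_mem wU|_] := boolP (w \in U); first by rewrite mulr1.
    by rewrite mulr0; exact: prodr_ge0.
  rewrite integral_prod_iid//; elim: k {U mU mp} => [|k IH].
    by rewrite expe0 expr0.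
  rewrite expeS exprS EFinM lee_pmul//; first last.
    by rewrite expe_ge0//; apply: integral_ge0 => y _; rewrite lee_fin.
  by apply: integral_ge0 => y _; rewrite lee_fin.
by rewrite EFinM lee_pdivlMl.
Qed.

End iid.
End independence.

(** * Laplace transforms bounded by two moments *)

Section moments.
Context {R : realType} (nu : probability (measurableTypeR R) R) (m r : R).
Hypothesis nu_lt0 : nu `]-oo, 0[%classic = 0%E.
Hypothesis nu_mean : (\int[nu]_(x in `[0%R, +oo[) x%:E = m%:E)%E.
Hypothesis nu_moment2 : (\int[nu]_(x in `[0%R, +oo[) (x ^+ 2)%:E = r%:E)%E.

Let mD : measurable (`[0%R, +oo[%classic : set R). Proof. exact: measurable_itv. Qed.

Let id_ge0 (x : R) : [set` `[0%R, +oo[] x -> 0 <= x.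
Proof. by rewrite /= in_itv/= andbT. Qed.

Lemma integral_nneg_support (f : R -> R) : measurable_fun [set: R] f ->
  (forall x, 0 <= f x) ->
  (\int[nu]_x (f x)%:E = \int[nu]_(x in `[0%R, +oo[) (f x)%:E)%E.
Proof.
move=> mf f0; rewrite (@ge0_negligible_integral _ _ _ nu _ `]-oo, 0[%classic)//.
- by congr integral; rewrite setTD setCitvl.
- exact/measurable_EFinP.
- by move=> x _; rewrite lee_fin.
Qed.

Let integral_cst1 : (\int[nu]_(x in `[0%R, +oo[) (1 : \bar R) = 1)%E.
Proof.
have := @integral_nneg_support (cst 1) (measurable_cst _) (fun=> ler01).
rewrite /= => <-; rewrite integral_cst//.
by rewrite [X in (_ * X)%E]probability_setT mule1.
Qed.

Lemma moment1_ge0 : 0 <= m.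
Proof.
by rewrite -lee_fin -nu_mean; apply: integral_ge0 => x /id_ge0; rewrite lee_fin.
Qed.

Lemma moment2_ge0 : 0 <= r.
Proof.
rewrite -lee_fin -nu_moment2; apply: integral_ge0 => x _.
by rewrite lee_fin sqr_ge0.
Qed.

Let integral_quadratic (a b : R) : 0 <= a -> 0 <= b ->
  (\int[nu]_(x in `[0%R, +oo[) (1 + a * x + b * x ^+ 2)%:E =
   (1 + a * m + b * r)%:E)%E.
Proof.
move=> a0 b0.
under eq_integral do rewrite EFinD EFinD (EFinM a) (EFinM b).
have mx : measurable_fun (`[0%R, +oo[%classic : set R) (fun x : R => x%:E).
  exact/measurable_EFinP.
have mx2 : measurable_fun (`[0%R, +oo[%classic : set R) (fun x : R => (x ^+ 2)%:E).
  by apply/measurable_EFinP; exact: measurable_funX.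
rewrite ge0_integralD//; last 4 first.
- move=> x /id_ge0 x0; rewrite adde_ge0// lee_fin//.
  exact: mulr_ge0.
- by apply: emeasurable_funD => //; exact: measurable_funeM.
- by move=> x /id_ge0 x0; rewrite lee_fin mulr_ge0// sqr_ge0.
- exact: measurable_funeM.
rewrite ge0_integralD//; last 2 first.
- by move=> x /id_ge0 x0; rewrite lee_fin mulr_ge0.
- exact: measurable_funeM.
rewrite integral_cst1 !ge0_integralZl_EFin//.
  by rewrite nu_mean nu_moment2 -!EFinM -!EFinD.
by move=> x _; rewrite lee_fin sqr_ge0.
Qed.

(** Truncation keeps the exponential factor of the quadratic bound below [expR (s * b)], while
    [Num.min x b <= x] brings in the moments of the untruncated law. *)
Lemma laplace_truncated s b : 0 <= s -> 0 <= b ->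
  (\int[nu]_x (expR (s * Num.min x b))%:E <=
   (1 + s * m + s ^+ 2 * expR (s * b) * r)%:E)%E.
Proof.
move=> s0 b0.
have mf : measurable_fun [set: R] (fun x => expR (s * Num.min x b)).
  apply: measurableT_comp => //; apply: measurable_funM => //.
  exact: measurable_minr.
rewrite integral_nneg_support//.
rewrite -integral_quadratic//; last by rewrite mulr_ge0 ?sqr_ge0 ?expR_ge0.
apply: ge0_le_integral => //.
- exact/measurable_EFinP/measurable_funTS.
- apply/measurable_EFinP; apply: measurable_funD.
    by apply: measurable_funD => //; exact: measurable_funM.
  by apply: measurable_funM => //; exact: measurable_funX.
move=> x /id_ge0 x0; rewrite lee_fin.
set z := Num.min x b.
have z0 : 0 <= z by rewrite le_min x0.
have zx : z <= x by rewrite ge_min lexx.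
have zb : z <= b by rewrite ge_min lexx orbT.
apply: (le_trans (expR_le_quadratic (mulr_ge0 s0 z0))).
have h1 : s * z <= s * x by rewrite ler_wpM2l.
have h2 : (s * z) ^+ 2 * expR (s * z) <= s ^+ 2 * expR (s * b) * x ^+ 2.
  rewrite exprMn mulrAC ler_pM ?mulr_ge0 ?sqr_ge0 ?expR_ge0//.
    by rewrite ler_wpM2l ?sqr_ge0// ler_expR ler_wpM2l.
  by rewrite ler_sqr.
by rewrite lerD// lerD2l.
Qed.

(** For the lower tail nonnegativity takes the place of truncation: the quadratic bound on
    [expR (- y)] carries no exponential factor. *)
Lemma laplace_neg s : 0 <= s ->
  (\int[nu]_x (expR (- (s * x)))%:E <= (1 - s * m + s ^+ 2 * r)%:E)%E.
Proof.
move=> s0.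
have mf : measurable_fun [set: R] (fun x => expR (- (s * x))).
  apply: (measurableT_comp (@measurable_expR R)).
  by apply: (measurableT_comp (@oppr_measurable R _)); exact: measurable_funM.
rewrite integral_nneg_support//.
have mx : measurable_fun (`[0%R, +oo[%classic : set R) (fun x : R => x%:E).
  exact/measurable_EFinP.
have mx2 : measurable_fun (`[0%R, +oo[%classic : set R) (fun x : R => (x ^+ 2)%:E).
  by apply/measurable_EFinP; exact: measurable_funX.
(* The term [s * m] is kept on the left so that all integrands are nonnegative. *)
have h : (\int[nu]_(x in `[0%R, +oo[) (expR (- (s * x)))%:E + (s * m)%:E <=
          (1 + s ^+ 2 * r)%:E)%E.
  have -> : 1 + s ^+ 2 * r = 1 + 0 * m + s ^+ 2 * r by rewrite mul0r addr0.
  rewrite -integral_quadratic// ?sqr_ge0//.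
  have -> : (s * m)%:E = (\int[nu]_(x in `[0%R, +oo[) (s%:E * x%:E))%E.
    by rewrite ge0_integralZl_EFin// nu_mean.
  have mexp : measurable_fun (`[0%R, +oo[%classic : set R)
      (fun x => (expR (- (s * x)))%:E).
    exact/measurable_EFinP/measurable_funTS.
  have msx : measurable_fun (`[0%R, +oo[%classic : set R) (fun x => s%:E * x%:E)%E.
    exact: measurable_funeM.
  rewrite -ge0_integralD//; last by move=> x /id_ge0 x0; rewrite lee_fin mulr_ge0.
  apply: ge0_le_integral => //.
  - move=> x /id_ge0 x0; rewrite adde_ge0// lee_fin ?expR_ge0//.
    exact: mulr_ge0.
  - exact: emeasurable_funD.
  - apply/measurable_EFinP; apply: measurable_funD.
      by apply: measurable_funD => //; exact: measurable_funM.
    by apply: measurable_funM => //; exact: measurable_funX.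
  move=> x /id_ge0 x0; rewrite -EFinM -EFinD lee_fin.
  have := expRN_le_quadratic (mulr_ge0 s0 x0).
  by rewrite exprMn; lra.
rewrite -leeBrDr// in h; apply: (le_trans h).
by rewrite -EFinB lee_fin; lra.
Qed.

Lemma sum_nat_lt_sqr (y : R) M : 0 <= y ->
  \sum_(n < M) n%:R * (n%:R < y)%R%:R <= y ^+ 2.
Proof.
move=> y0.
(* The second bound, free of [y], serves the case where term [M] is present: the new sum is then at
   most [M ^ 2], and [M < y]. *)
suff : \sum_(n < M) n%:R * (n%:R < y)%R%:R <= y ^+ 2 /\
       \sum_(n < M) n%:R * (n%:R < y)%R%:R + M%:R <= M%:R ^+ 2 :> R by case.
elim: M => [|M [IH1 IH2]].
  by rewrite big_ord0 addr0 sqr_ge0 expr0n.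
have M0 : 0 <= M%:R :> R by [].
have MS : M.+1%:R = M%:R + 1 :> R by rewrite natr1.
rewrite big_ord_recr/=; have [My|yM] := ltP M%:R y; last first.
  by rewrite mulr0 addr0 MS; split=> //; nra.
rewrite mulr1 MS; split; last by nra.
by apply: (le_trans IH2); rewrite ler_sqr ?nnegrE// ltW.
Qed.

End moments.

Lemma measurable_gtr_set d (T : measurableType d) (R : realType) (f : T -> R) (a : R) :
  measurable_fun [set: T] f -> measurable [set w | a < f w].
Proof.
move=> mf; rewrite -[X in measurable X]setTI.
rewrite (_ : [set w | a < f w] = f @^-1` `]a, +oo[); first exact: mf.
by apply/seteqP; split => w /=; rewrite in_itv/= andbT.
Qed.

Lemma measurable_ger_set d (T : measurableType d) (R : realType) (f : T -> R) (a : R) :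
  measurable_fun [set: T] f -> measurable [set w | a <= f w].
Proof.
move=> mf; rewrite -[X in measurable X]setTI.
rewrite (_ : [set w | a <= f w] = f @^-1` `[a, +oo[); first exact: mf.
by apply/seteqP; split => w /=; rewrite in_itv/= andbT.
Qed.

Lemma expR_sum_ord (R : realType) k (f : nat -> R) :
  \prod_(i < k) expR (f i) = expR (\sum_(i < k) f i).
Proof.
elim: k => [|k IH]; first by rewrite !big_ord0 expR0.
by rewrite !big_ord_recr/= IH expRD.
Qed.

(** The square of [u / 4 <= expR (u / 4)]. With [u = ln N] it bounds [(ln N) ^ 2 / sqrt N]. *)
Lemma sqr_mul_expRN_le (R : realType) (u : R) : 0 <= u ->
  u ^+ 2 * expR (- (u / 2)) <= 16.
Proof.
move=> u0; have h := expR_ge1Dx (u / 4).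
have e : expR (u / 2) = expR (u / 4) ^+ 2.
  by rewrite expr2 -expRD; congr expR; field.
have h2 : u / 4 <= expR (u / 4) by lra.
rewrite expRN ler_pdivrMr ?expR_gt0// e.
have : (u / 4) ^+ 2 <= expR (u / 4) ^+ 2.
  by rewrite ler_sqr ?nnegrE ?expR_ge0// divr_ge0.
rewrite expr_div_n ler_pdivrMr// => h3; apply: (le_trans h3).
by rewrite mulrC -natrX.
Qed.

Lemma sum_inv_sqr_le (R : realType) M : \sum_(n < M) (n.+1%:R ^+ 2)^-1 <= 2 :> R.
Proof.
suff : \sum_(n < M.+1) (n.+1%:R ^+ 2)^-1 <= 2 - M.+1%:R^-1 :> R.
  move=> h; apply: (@le_trans _ _ (2 - M.+1%:R^-1)); last by rewrite gerBl.
  by apply: le_trans h; rewrite big_ord_recr/= lerDl invr_ge0 sqr_ge0.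
elim: M => [|M IH]; first by rewrite big_ord_recl big_ord0 expr1n invr1; lra.
rewrite big_ord_recr/=.
suff h : (M.+2%:R ^+ 2)^-1 <= M.+1%:R^-1 - M.+2%:R^-1 :> R.
  by rewrite (le_trans (lerD IH h))// addrA subrK.
have p1 : 0 < M.+1%:R :> R by [].
have p2 : 0 < M.+2%:R :> R by [].
have e : M.+2%:R = M.+1%:R + 1 :> R by rewrite natr1.
have -> : M.+1%:R^-1 - M.+2%:R^-1 = (M.+1%:R * M.+2%:R)^-1 :> R.
  by rewrite e; field; rewrite -?e !gt_eqF.
rewrite lef_pV2 ?posrE ?mulr_gt0 ?exprn_gt0//.
by rewrite expr2 ler_pM2r// e lerDl.
Qed.

Lemma expR_pow_le (R : realType) k (a x : R) : 0 <= 1 + x ->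
  (expR a)^-1 * (1 + x) ^+ k <= expR (k%:R * x - a).
Proof.
move=> x0; rewrite -expRN [_ - a]addrC expRD ler_wpM2l ?expR_ge0//.
by rewrite expRM_natl lerXn2r ?nnegrE ?expR_ge0// expR_ge1Dx.
Qed.

(** * Chernoff bounds for all partial sums at once *)

Section deviation.
Context d (T : measurableType d) (R : realType) (P : probability T R).
Variables (nu : probability (measurableTypeR R) R) (m r : R).
Hypothesis nu_lt0 : nu `]-oo, 0[%classic = 0%E.
Hypothesis nu_mean : (\int[nu]_(x in `[0%R, +oo[) x%:E = m%:E)%E.
Hypothesis nu_moment2 : (\int[nu]_(x in `[0%R, +oo[) (x ^+ 2)%:E = r%:E)%E.

Let m_ge0 : 0 <= m. Proof. exact: moment1_ge0 nu_mean. Qed.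
Let r_ge0 : 0 <= r. Proof. exact: moment2_ge0 nu_moment2. Qed.

Definition deviation (X : nat -> T -> R) (M : nat) (eta : R) : set T :=
  \big[setU/set0]_(k < M.+1)
    [set w | eta < `|\sum_(i < k) X i w - k%:R * m|].

Section iid.
Variables (G : nat -> set (set T)) (X : nat -> T -> R).
Hypothesis iidX : iid_filtration P nu G X.
Let mX := iid_measurable iidX.

Lemma measurable_deviation M eta : measurable (deviation X M eta).
Proof.
apply: bigsetU_measurable => k _; apply: measurable_gtr_set.
apply: measurableT_comp => //; apply: measurable_funB => //.
by apply: measurable_sum => i; exact: mX.
Qed.

Lemma iid_gt_law i b : P [set w | b < X i w] = nu `]b, +oo[%classic.
Proof.
have sT : <<s G i >> [set: T].
  by rewrite -[X in <<s _ >> X](@setD0 _ setT); apply: sigma_algebraCD; exact: sigma_algebra0.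
have := iid_indep iidX sT (measurable_itv `]b, +oo[).
rewrite setTI [P [set: T]]probability_setT mul1e => <-.
by congr (P _); apply/seteqP; split => w /=; rewrite in_itv/= andbT.
Qed.

Lemma upper_tail s b k a : 0 <= s -> 0 <= b ->
  (P [set w | expR a <= \prod_(i < k) expR (s * Num.min (X i w) b)]%R <=
   (expR (k%:R * (s * m + s ^+ 2 * expR (s * b) * r) - a))%:E)%E.
Proof.
move=> s0 b0.
have mf : measurable_fun [set: R] (fun x => expR (s * Num.min x b)).
  apply: measurableT_comp => //; apply: measurable_funM => //.
  exact: measurable_minr.
have rho0 : 0 <= 1 + s * m + s ^+ 2 * expR (s * b) * r.
  by rewrite !addr_ge0// !mulr_ge0// ?sqr_ge0 ?expR_ge0.
apply: le_trans (markov_prod_iid iidX k mf (fun=> expR_ge0 _) (expR_gt0 a) rho0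
  (laplace_truncated nu_lt0 nu_mean nu_moment2 s0 b0)) _.
by rewrite lee_fin -addrA expR_pow_le ?addrA.
Qed.

Lemma lower_tail s k a : 0 <= s ->
  (P [set w | expR a <= \prod_(i < k) expR (- (s * X i w))]%R <=
   (expR (k%:R * (- (s * m) + s ^+ 2 * r) - a))%:E)%E.
Proof.
move=> s0.
have mf : measurable_fun [set: R] (fun x => expR (- (s * x))).
  apply: (measurableT_comp (@measurable_expR R)).
  by apply: (measurableT_comp (@oppr_measurable R _)); exact: measurable_funM.
have lap := laplace_neg nu_lt0 nu_mean nu_moment2 s0.
have rho0 : 0 <= 1 - s * m + s ^+ 2 * r.
  rewrite -lee_fin; apply: le_trans lap; apply: integral_ge0 => x _.
  by rewrite lee_fin expR_ge0.
apply: le_trans (markov_prod_iid iidX k mf (fun=> expR_ge0 _) (expR_gt0 a) rho0 lap) _.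
by rewrite lee_fin -addrA expR_pow_le ?addrA.
Qed.

(** Unless one of the first [M] variables exceeds [b], truncated and true sums agree, and a
    deviation pushes a product of exponentials over its Chernoff threshold. The exponent at [M]
    dominates those for [k <= M], so the union over [k] costs the factor [M.+1]. *)
Lemma deviation_bound s b M eta : 0 <= s -> 0 <= b ->
  (P (deviation X M eta) <= M%:R%:E * nu `]b, +oo[%classic +
    (2 * M.+1%:R * expR (M%:R * (s ^+ 2 * expR (s * b) * r) - s * eta))%:E)%E.
Proof.
move=> s0 b0.
pose J := \big[setU/set0]_(i < M) [set w | b < X i w].
pose U k := [set w | expR (s * (k%:R * m + eta)) <=
  \prod_(i < k) expR (s * Num.min (X i w) b)].
pose L k := [set w | expR (- (s * (k%:R * m - eta))) <=
  \prod_(i < k) expR (- (s * X i w))].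
have mJ : measurable J.
  by apply: bigsetU_measurable => i _; apply: measurable_gtr_set; exact: mX.
have mU k : measurable (U k).
  apply: measurable_ger_set; apply: measurable_prod => i _.
  apply: measurableT_comp => //; apply: measurable_funM => //.
  by apply: measurable_minr => //; exact: mX.
have mL k : measurable (L k).
  apply: measurable_ger_set; apply: measurable_prod => i _.
  apply: (measurableT_comp (@measurable_expR R)).
  apply: (measurableT_comp (@oppr_measurable R _)).
  by apply: measurable_funM => //; exact: mX.
have sub : deviation X M eta `<=` J `|` \big[setU/set0]_(k < M.+1) (U k `|` L k).
  rewrite /deviation /J.
  rewrite -(bigcup_mkord M.+1 (fun k => [set w | eta < `|\sum_(i < k) X i w - k%:R * m|])).
  rewrite -(bigcup_mkord M (fun i => [set w | b < X i w])).
  rewrite -(bigcup_mkord M.+1 (fun k => U k `|` L k)) => w [k /= kM hk].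
  have [[i /= iM bX]|nJ] := pselect ((\bigcup_(i < M) [set w | b < X i w]) w).
    by left; exists i.
  right; exists k => //.
  have Xb i : (i < M)%N -> X i w <= b.
    by move=> iM; rewrite leNgt; apply/negP => bX; apply: nJ; exists i.
  move: hk; rewrite lter_normr => /orP[h|h]; [left|right]; rewrite /U /L/=.
    rewrite (expR_sum_ord k (fun i => s * Num.min (X i w) b)) ler_expR.
    rewrite -mulr_sumr ler_wpM2l//.
    rewrite (eq_bigr (fun i : 'I_k => X i w)); first by lra.
    move=> i _; apply/min_idPl/Xb; apply: leq_trans (ltn_ord i) _.
    by rewrite -ltnS.
  rewrite (expR_sum_ord k (fun i => - (s * X i w))) ler_expR sumrN lerN2.
  by rewrite -mulr_sumr ler_wpM2l//; lra.
have es1 : 1 <= expR (s * b) by rewrite -expR0 ler_expR mulr_ge0.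
pose c := s ^+ 2 * expR (s * b) * r.
have c0 : 0 <= c by rewrite !mulr_ge0// ?sqr_ge0 ?expR_ge0.
have PU k : (k <= M)%N -> (P (U k) <= (expR (M%:R * c - s * eta))%:E)%E.
  move=> kM; apply: (le_trans (upper_tail k _ s0 b0)).
  rewrite lee_fin ler_expR.
  have : k%:R * c <= M%:R * c by rewrite ler_wpM2r// ler_nat.
  by rewrite -/c; lra.
have PL k : (k <= M)%N -> (P (L k) <= (expR (M%:R * c - s * eta))%:E)%E.
  move=> kM; apply: (le_trans (lower_tail k _ s0)).
  rewrite lee_fin ler_expR.
  have h1 : k%:R * c <= M%:R * c by rewrite ler_wpM2r// ler_nat.
  have h2 : k%:R * (s ^+ 2 * r) <= k%:R * c.
    have -> : c = s ^+ 2 * r * expR (s * b) by rewrite /c mulrAC.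
    by rewrite ler_wpM2l// ler_peMr// mulr_ge0// sqr_ge0.
  by lra.
apply: (@le_trans _ _ (P (J `|` \big[setU/set0]_(k < M.+1) (U k `|` L k)))).
  apply: le_measure => //; rewrite inE; first exact: measurable_deviation.
  by apply: measurableU => //; apply: bigsetU_measurable => k _; exact: measurableU.
apply: le_trans (measureU2 _ mJ _) _.
  by apply: bigsetU_measurable => k _; exact: measurableU.
apply: leeD.
  apply: (le_trans (@Boole_inequality _ _ _ P (fun i => [set w | b < X i w]) M _)).
    by move=> i _; apply: measurable_gtr_set; exact: mX.
  rewrite (eq_bigr (fun=> nu `]b, +oo[%classic)); last first.
    by move=> i _; exact: iid_gt_law.
  by rewrite sumr_const card_ord mule_natl.
apply: (le_trans (@Boole_inequality _ _ _ P (fun k => U k `|` L k) M.+1 _)).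
  by move=> i _; exact: measurableU.
apply: (@le_trans _ _ (\sum_(k < M.+1) (2 * expR (M%:R * c - s * eta))%:E)%E).
  apply: lee_sum => k _; apply: le_trans (measureU2 _ (mU k) (mL k)) _.
  have kM : (k <= M)%N by rewrite -ltnS.
  rewrite mulr_natl mulr2n EFinD; exact: leeD (PU _ kM) (PL _ kM).
rewrite sumEFin lee_fin sumr_const card_ord -/c -[X in X <= _]mulr_natl.
by rewrite mulrA (mulrC _ 2).
Qed.

End iid.
End deviation.

(** * Summability and Borel-Cantelli *)

Section complete_convergence.
Context d (T : measurableType d) (R : realType) (P : probability T R).
Variables (nu : probability (measurableTypeR R) R) (m r : R).
Hypothesis nu_lt0 : nu `]-oo, 0[%classic = 0%E.
Hypothesis nu_mean : (\int[nu]_(x in `[0%R, +oo[) x%:E = m%:E)%E.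
Hypothesis nu_moment2 : (\int[nu]_(x in `[0%R, +oo[) (x ^+ 2)%:E = r%:E)%E.

Let r_ge0 : 0 <= r. Proof. exact: moment2_ge0 nu_moment2. Qed.

(** Exchanging sum and integral leaves, pointwise, [sum_nat_lt_sqr] at [x / delta]. This is where
    the second moment pays for the untruncated part. *)
Lemma sum_tail_le (delta : R) M : 0 < delta ->
  (\sum_(n < M) n.+1%:R%:E * nu `](delta * n.+1%:R)%R, +oo[%classic <=
   (r / delta ^+ 2)%:E)%E.
Proof.
move=> delta0.
pose f (n : nat) (x : R) : R := n.+1%:R * \1_(`](delta * n.+1%:R)%R, +oo[%classic) x.
have f0 n x : 0 <= f n x by rewrite mulr_ge0.
have mf n : measurable_fun [set: R] (f n).
  by apply: measurable_funM => //; exact: measurable_indic.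
have fE n x : f n x = n.+1%:R * (delta * n.+1%:R < x)%R%:R.
  rewrite /f indicE; congr (_ * (nat_of_bool _)%:R).
  by apply/idP/idP => [/set_mem|h]; [|apply/mem_set]; rewrite /= in_itv/= andbT.
rewrite (eq_bigr (fun n : 'I_M => \int[nu]_x (f n x)%:E)%E); last first.
  move=> n _.
  under eq_integral do rewrite /f EFinM.
  rewrite ge0_integralZl_EFin//; last first.
    by apply/measurable_EFinP; exact: measurable_indic.
  by rewrite integral_indic// setIT.
have mfE (n : 'I_M) : measurable_fun [set: measurableTypeR R] (fun x => (f n x)%:E).
  by apply/measurable_EFinP; exact: mf.
have fE0 (n : 'I_M) x : [set: measurableTypeR R] x -> (0 <= (f n x)%:E)%E.
  by rewrite lee_fin.
rewrite -(ge0_integral_sum nu measurableT mfE fE0).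
under eq_integral do rewrite sumEFin.
rewrite (integral_nneg_support nu_lt0); last 2 first.
  by apply: measurable_sum => n; exact: mf.
  by move=> x; exact: sumr_ge0.
apply: (@le_trans _ _
  (\int[nu]_(x in `[0%R, +oo[) ((delta ^- 2)%:E * (x ^+ 2)%:E))%E).
  apply: ge0_le_integral => //.
  - by move=> x _; rewrite lee_fin sumr_ge0.
  - apply/measurable_EFinP/measurable_funTS; apply: measurable_sum => n.
    exact: mf.
  - apply: measurable_funeM; apply/measurable_EFinP; exact: measurable_funX.
  move=> x /=; rewrite in_itv/= andbT => x0; rewrite -EFinM lee_fin.
  have := sum_nat_lt_sqr M.+1 (divr_ge0 x0 (ltW delta0)).
  rewrite big_ord_recl mul0r add0r expr_div_n [leRHS]mulrC; apply: le_trans.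
  apply: ler_sum => n _; rewrite fE.
  by rewrite ltr_pdivlMr// (mulrC delta).
have sq0 (x : measurableTypeR R) : [set` `[0%R, +oo[] x -> (0 <= (x ^+ 2)%:E)%E.
  by rewrite lee_fin sqr_ge0.
have d0 : 0 <= delta ^- 2 by rewrite invr_ge0 sqr_ge0.
rewrite (ge0_integralZl_EFin nu _ sq0 _ d0)//; last first.
  by apply/measurable_EFinP; exact: measurable_funX.
by rewrite nu_moment2 -EFinM mulrC.
Qed.

(* Chernoff's bound at [s = A ln N / N] for variables truncated at [delta N]. *)
Lemma deviation_bound_complete (L : nat) (eps : R) : 0 < eps ->
  exists delta K : R, [/\ 0 < delta, 0 <= K &
  forall N G (X : nat -> T -> R), (0 < N)%N -> iid_filtration P nu G X ->
  (P (deviation m X (L * N) (eps * N%:R)) <=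
   L%:R%:E * (N%:R%:E * nu `](delta * N%:R)%R, +oo[%classic) +
   (K * (N%:R ^+ 2)^-1)%:E)%E].
Proof.
(* These values give [s * (eps * N) = 3 ln N], a factor [N ^ -3] that outweighs the roughly [L N]
   indices, and [s * (delta * N) = (ln N) / 2], so that truncation costs only the factor
   [sqrt N]. *)
move=> eps0; pose A := 3 / eps; pose delta := eps / 6.
have A0 : 0 < A by rewrite divr_gt0.
pose K := 2 * (L%:R + 1) * expR (16 * L%:R * A ^+ 2 * r).
have L0 : 0 <= L%:R :> R by [].
exists delta, K; split; first by rewrite divr_gt0.
  by rewrite !mulr_ge0 ?expR_ge0// addr_ge0.
move=> N G X N0 iidX; have N0R : 0 < N%:R :> R by rewrite ltr0n.
pose u := ln N%:R : R.
have u0 : 0 <= u by rewrite ln_ge0// ler1n.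
have eu : expR u = N%:R by rewrite lnK.
pose s := A * u / N%:R.
have s0 : 0 <= s by rewrite divr_ge0// mulr_ge0// ltW.
have b0 : 0 <= delta * N%:R by rewrite mulr_ge0// divr_ge0// ltW.
apply: (le_trans (deviation_bound nu_lt0 nu_mean nu_moment2 iidX (L * N) (eps * N%:R) s0 b0)).
rewrite natrM EFinM -muleA leeD2l// lee_fin.
have e1 : s * (eps * N%:R) = 3 * u by rewrite /s /A; field; rewrite !gt_eqF.
have e2 : s * (delta * N%:R) = u / 2.
  by rewrite /s /A /delta; field; rewrite !gt_eqF.
rewrite e1 e2.
have e3 : L%:R * N%:R * (s ^+ 2 * expR (u / 2) * r) =
  L%:R * A ^+ 2 * r * (u ^+ 2 * expR (- (u / 2))).
  have -> : expR (- (u / 2)) = expR (u / 2) / N%:R.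
    by rewrite -eu -expRN -expRD; congr expR; field.
  by rewrite /s; field; rewrite gt_eqF.
rewrite e3.
have h1 : L%:R * A ^+ 2 * r * (u ^+ 2 * expR (- (u / 2))) <= 16 * L%:R * A ^+ 2 * r.
  have -> : 16 * L%:R * A ^+ 2 * r = L%:R * A ^+ 2 * r * 16 by ring.
  apply: ler_wpM2l; last exact: sqr_mul_expRN_le.
  by apply: mulr_ge0 => //; apply: mulr_ge0 => //; exact: sqr_ge0.
rewrite expRD [expR (- (3 * u))]expRN.
have -> : expR (3 * u) = N%:R ^+ 3 by rewrite -eu -expRM_natl.
have h2 : (L * N).+1%:R <= (L%:R + 1) * N%:R :> R.
  by rewrite -natr1 natrM mulrDl mul1r lerD2l ler1n.
have -> : K * (N%:R ^+ 2)^-1 = 2 * ((L%:R + 1) * N%:R) *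
    (expR (16 * L%:R * A ^+ 2 * r) / N%:R ^+ 3).
  by rewrite /K; field; rewrite gt_eqF.
apply: ler_pM; rewrite ?mulr_ge0 ?expR_ge0 ?invr_ge0 ?exprn_ge0//.
  by rewrite ler_pM2l// -natrM.
by rewrite ler_pM2r ?invr_gt0 ?exprn_gt0// ler_expR.
Qed.

(** Borel-Cantelli for the deviation events, whose probabilities are summable whatever the joint law
    of the rows [X N]. *)
Theorem complete_convergence (G : nat -> nat -> set (set T)) (X : nat -> nat -> T -> R)
    (L : nat) (eps : R) : 0 < eps ->
  (forall N, (0 < N)%N -> iid_filtration P nu (G N) (X N)) ->
  {ae P, forall w, \forall N \near \oo, forall k, (k <= L * N)%N ->
    `|\sum_(i < k) X N i w - k%:R * m| <= eps * N%:R}.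
Proof.
move=> eps0 iidX.
have [delta [K [delta0 K0 devb]]] := deviation_bound_complete L eps0.
pose F n := deviation m (X n.+1) (L * n.+1) (eps * n.+1%:R).
have mF n : measurable (F n) by apply: measurable_deviation; exact: iidX.
exists (lim_sup_set F); split.
- by apply: bigcap_measurable => // n _; exact: bigcup_measurable.
- apply: lim_sup_set_cvg0 => //.
  apply: (@le_lt_trans _ _ (L%:R * (r / delta ^+ 2) + K * 2)%:E); last exact: ltry.
  apply: lime_le; first exact: is_cvg_nneseries.
  apply: nearW => M; rewrite big_mkord.
  apply: (@le_trans _ _ (\sum_(n < M) (L%:R%:E *
    (n.+1%:R%:E * nu `](delta * n.+1%:R)%R, +oo[%classic) +
    (K * (n.+1%:R ^+ 2)^-1)%:E)))%E.
    by apply: lee_sum => n _; exact: devb (iidX _ _).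
  rewrite big_split/= EFinD leeD//; last first.
    by rewrite sumEFin lee_fin -mulr_sumr ler_wpM2l// sum_inv_sqr_le.
  rewrite -ge0_sume_distrr; last by move=> n _; rewrite mule_ge0.
  by rewrite EFinM lee_wpmul2l// sum_tail_le.
move=> w; apply: contra_notP => /= nlim.
have /existsNP[n0 nF] : ~ forall n, (\bigcup_(j >= n) F j) w.
  by move=> h; apply: nlim => n _; exact: h.
exists n0.+1 => // -[//|N] /= n0N k kL.
rewrite leNgt; apply/negP => dev; apply: nF; exists N => //.
rewrite /F /deviation -(bigcup_mkord _ (fun k =>
  [set w | eps * N.+1%:R < `|\sum_(i < k) X N.+1 i w - k%:R * m|])).
by exists k.
Qed.

End complete_convergence.

(** * Laws of the service times *)

Lemma measure_halfline_unique (R : realType)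
    (m1 m2 : {measure set (measurableTypeR R) -> \bar R}) :
  (m1 setT < +oo)%E ->
  (forall x : R, m1 `]x, +oo[%classic = m2 `]x, +oo[%classic) ->
  forall B : set R, measurable B -> m1 B = m2 B.
Proof.
move=> m1oo m12 B mB.
pose g (n : nat) : set (measurableTypeR R) := `]- n%:R, +oo[%classic.
have Gg n : @RGenOInfty.G R (g n) by exists (- n%:R).
have GI : setI_closed (@RGenOInfty.G R).
  move=> _ _ [x ->] [y ->]; exists (Num.max x y).
  by apply/seteqP; split => z /=; rewrite !in_itv/= !andbT gt_max => /andP.
have gT : \bigcup_k g k = setT.
  rewrite -subTset => x _; exists (Num.truncn `|x|).+1 => //=.
  rewrite /g/= in_itv/= andbT ltrNl.
  by rewrite (le_lt_trans (ler_norm _))// normrN truncnS_gt.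
have mG : measurable = <<s @RGenOInfty.G R >> :> set (set (measurableTypeR R)).
  exact: RGenOInfty.measurableE.
apply: (measure_unique _ _ mG GI Gg gT) => //.
  by move=> _ [x ->].
move=> n; apply: le_lt_trans m1oo; apply: le_measure => //; rewrite inE//.
by rewrite mG; apply: sub_sigma_algebra; exact: Gg.
Qed.

(** For fixed [A] both sides are finite measures in [B], so agreement on half-lines suffices. *)
Lemma indep_halfline d (T : measurableType d) (R : realType) (P : probability T R)
    (nu : probability (measurableTypeR R) R) (X : T -> R) (A : set T) :
  measurable_fun [set: T] X -> measurable A ->
  (forall x, P (A `&` [set w | X w <= x]) = (P A * nu `]-oo, x]%classic)%E) ->
  forall B : set R, measurable B -> P (A `&` X @^-1` B) = (P A * nu B)%E.
Proof.
move=> mX mA h B mB.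
have mX' : @measurable_fun _ _ T (measurableTypeR R) setT X by exact: mX.
pose m0 := (pushforward (mrestr P mA) (X : T -> measurableTypeR R)
  : {measure set (measurableTypeR R) -> \bar R}).
pose m1 := m0 mX'.
have PA0 : 0 <= fine (P A) by rewrite fine_ge0.
pose m2 : {measure set (measurableTypeR R) -> \bar R} := mscale (NngNum PA0) nu.
have m1E C : m1 C = P (A `&` X @^-1` C) by rewrite /m1/= /pushforward /mrestr setIC.
have m2E C : m2 C = (P A * nu C)%E.
  by rewrite /m2/= /mscale/= fineK// fin_num_measure.
rewrite -m1E -m2E; apply: measure_halfline_unique => // [|x].
  rewrite m1E preimage_setT setIT (le_lt_trans (probability_le1 P mA))//.
  exact: ltry.
have mXx : measurable [set w | X w <= x].
  rewrite -[X in measurable X]setTI.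
  rewrite (_ : [set w | X w <= x] = X @^-1` `]-oo, x]); first exact: mX.
  by apply/seteqP; split => w /=; rewrite in_itv/=.
rewrite m1E m2E -setCitvl probability_setC// muleBr ?fin_num_adde_defr ?fin_num_measure//.
rewrite mule1 -h -measureD//.
  by rewrite (le_lt_trans (probability_le1 P mA))// ltry.
Qed.

(** * The exponential distribution and its moments *)

Section exponential.
Context {R : realType} (rate : R).
Hypothesis rate_gt0 : 0 < rate.

Let pdf_ge0 (x : R) : (0 <= (exponential_pdf rate x)%:E)%E.
Proof. by rewrite lee_fin exponential_pdf_ge0// ltW. Qed.

Lemma exponential_prob_lt0 : exponential_prob rate `]-oo, 0[ = 0%E.
Proof.
rewrite /exponential_prob integral0_eq// => x /=; rewrite in_itv/= => x0.
by rewrite lt0_exponential_pdf.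
Qed.

Lemma exponential_cdf (x : R) : exponential_prob rate `]-oo, x] =
  (if 0 <= x then 1 - expR (- rate * x) else 0)%:E.
Proof.
case: leP => [x0|x0]; last first.
  rewrite /exponential_prob integral0_eq// => y /=; rewrite in_itv/= => yx.
  by rewrite lt0_exponential_pdf// (le_lt_trans yx).
have e : exponential_prob rate `[0, x] = (1 - expR (- rate * x))%:E.
  have [->|xn0] := eqVneq x 0.
    by rewrite set_itv1 /exponential_prob integral_set1 mulr0 expR0 subrr.
  by rewrite exponential_prob_itv0c// lt_neqAle eq_sym xn0.
rewrite -e (_ : `]-oo, x]%classic = `]-oo, 0[%classic `|` `[0, x]%classic).
  rewrite /exponential_prob ge0_integral_setU//=.
  - by rewrite -[X in (X + _)%E]/(exponential_prob rate _) exponential_prob_lt0 add0e.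
  - by apply/measurable_EFinP/measurable_funTS; exact: measurable_exponential_pdf.
  - rewrite disj_set2E; apply/eqP/seteqP; split => y //= [].
    by rewrite !in_itv/= => y0 /andP[]; rewrite leNgt y0.
apply/seteqP; split => y /=; rewrite !in_itv/=; last first.
  by move=> [y0|/andP[]//]; rewrite (le_trans (ltW y0)).
by move=> yx; have [y0|y0] := ltP y 0; [left|right]; rewrite ?y0.
Qed.

Lemma exponential_tail (x : R) : 0 <= x ->
  exponential_prob rate `]x, +oo[ = (expR (- rate * x))%:E.
Proof.
move=> x0.
have e0 : exponential_prob rate [set: R] = 1%E by exact: integral_exponential_pdf.
have : exponential_prob rate ([set: R]) =
    (exponential_prob rate `]-oo, x] + exponential_prob rate `]x, +oo[)%E.
  rewrite /exponential_prob -ge0_integral_setU//=.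
  - by congr integral; rewrite -[in RHS]setCitvl setUv.
  - by apply/measurable_EFinP/measurable_funTS; exact: measurable_exponential_pdf.
  - by rewrite -setCitvl; apply/disj_setPCl.
rewrite e0 exponential_cdf x0 addeC => h.
rewrite -[LHS](@addeK R (1 - expR (- rate * x))%:E)// -h -EFinB.
by congr EFin; ring.
Qed.

Section moments.
Context d (T : measurableType d) (P : probability T R) (X : {RV P >-> R}).
Hypothesis X_exp : forall B : set R, measurable B ->
  distribution P X B = exponential_prob rate B.

(** An exponential variable is nonnegative only almost surely, whereas the tail formula for
    expectations asks for it everywhere. The positive part has the same tails beyond any
    [x >= 0]. *)
Let Xp (w : T) : R := Num.max (X w) 0.

Let mXp : measurable_fun [set: T] Xp.
Proof. exact: measurable_maxr. Qed.

Let XpR : {RV P >-> R} := mfun_Sub (mem_set mXp : Xp \in mfun).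

Let Xp_tail (x : R) : 0 <= x -> P [set w | x < Xp w] = (expR (- rate * x))%:E.
Proof.
move=> x0; rewrite -exponential_tail// -X_exp//; congr (P _).
apply/seteqP; split => w /=; rewrite in_itv/= andbT /Xp lt_max; last by move=> ->.
by move=> /orP[//|]; rewrite ltNge x0.
Qed.

(** The mean is the integral of the tail [expR (- rate * x)], which is [rate^-1] times the
    density. *)
Lemma exponential_mean :
  (\int[P]_w (Xp w)%:E = (rate^-1)%:E)%E.
Proof.
have -> : (\int[P]_w (Xp w)%:E = 'E_P[XpR])%E by rewrite expectation_def.
rewrite ge0_expectation_ccdf; last by move=> w; rewrite /= /Xp le_max lexx orbT.
transitivity (\int[lebesgue_measure]_(r in `[0%R, +oo[)
    ((rate^-1)%:E * (exponential_pdf rate r)%:E))%E.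
  apply: eq_integral => r /set_mem/=; rewrite in_itv/= andbT => r0.
  rewrite exponential_pdfE// -EFinM mulKf ?gt_eqF// -Xp_tail//.
  by congr (P _); apply/seteqP; split => w /=; rewrite in_itv/= andbT.
have mpdf : measurable_fun (`[0%R, +oo[%classic : set (measurableTypeR R))
    (EFin \o exponential_pdf rate).
  by apply/measurable_EFinP/measurable_funTS; exact: measurable_exponential_pdf.
have pdf0 (x : measurableTypeR R) : [set` `[0%R, +oo[] x -> (0 <= (exponential_pdf rate x)%:E)%E by [].
have r0 : 0 <= rate^-1 by rewrite invr_ge0 ltW.
rewrite (ge0_integralZl_EFin _ _ pdf0 mpdf r0)//.
have -> : (\int[lebesgue_measure]_(x in `[0%R, +oo[) (exponential_pdf rate x)%:E = 1)%E.
  have := integral_exponential_pdf rate_gt0 => <-.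
  rewrite [RHS]integral_mkcond [LHS]integral_mkcond.
  apply: eq_integral => x _; rewrite !patchE in_setT.
  case: ifPn => //; rewrite notin_setE/= in_itv/= andbT => /negP; rewrite -ltNge.
  by move=> x0; rewrite lt0_exponential_pdf.
by rewrite mule1.
Qed.

(** Only finiteness matters: the tail of [Xp ^+ 2] at [r] is [expR (- rate * Num.sqrt r)], dominated
    by a multiple of the integrable [1 / (1 + r ^ 2)]. *)
Lemma exponential_moment2_fin : exists r : R,
  (\int[P]_w (Xp w ^+ 2)%:E = r%:E)%E.
Proof.
have mXp2 : measurable_fun [set: T] (fun w => Xp w ^+ 2) by exact: measurable_funX.
pose X2R : {RV P >-> R} := mfun_Sub (mem_set mXp2 : _ \in mfun).
suff h : (\int[P]_w (Xp w ^+ 2)%:E < +oo)%E.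
  exists (fine (\int[P]_w (Xp w ^+ 2)%:E)%E); rewrite fineK//.
  rewrite ge0_fin_numE//; apply: integral_ge0 => w _.
  by rewrite lee_fin sqr_ge0.
have -> : (\int[P]_w (Xp w ^+ 2)%:E = 'E_P[X2R])%E by rewrite expectation_def.
rewrite ge0_expectation_ccdf; last by move=> w; exact: sqr_ge0.
(* With [y = rate * Num.sqrt r], the bound [(y / 4) ^+ 4 <= expR y] reads
   [r ^+ 2 <= 256 / rate ^+ 4 * expR y]; the 1 is for [1 <= expR y]. *)
pose c := 1 + 256 / rate ^+ 4.
have c0 : 0 <= c by rewrite addr_ge0// divr_ge0// exprn_ge0// ltW.
apply: (@le_lt_trans _ _ (\int[lebesgue_measure]_(r in `[0%R, +oo[)
    (c%:E * ((oneDsqr r)^-1)%:E))%E).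
  apply: ge0_le_integral => //.
  - by apply: measurable_funTS; exact: ccdf_measurable.
  - apply: measurable_funeM; apply/measurable_EFinP/measurable_funTS.
    by apply: continuous_measurable_fun; exact: continuous_oneDsqrV.
  move=> r /=; rewrite in_itv/= andbT => r0.
  have s0 : 0 <= Num.sqrt r by exact: sqrtr_ge0.
  have -> : ccdf X2R r = (expR (- rate * Num.sqrt r))%:E.
    have Xp0 w : 0 <= Xp w by rewrite /Xp le_max lexx orbT.
    have sq w : (r < Xp w ^+ 2) = (Num.sqrt r < Xp w).
      by rewrite -[X in X < _ ^+ 2](sqr_sqrtr r0) ltr_sqr// nnegrE.
    rewrite -Xp_tail//; congr (P _).
    by apply/seteqP; split => w /=; rewrite in_itv/= andbT sq.
  rewrite -EFinM lee_fin mulNr expRN.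
  set y := rate * Num.sqrt r.
  have y0 : 0 <= y by rewrite mulr_ge0// ltW.
  have e4 : (y / 4) ^+ 4 <= expR y.
    have -> : expR y = expR (y / 4) ^+ 4.
      by rewrite -expRM_natl; congr expR; field.
    have ey : y / 4 <= expR (y / 4) by have := expR_ge1Dx (y / 4); lra.
    by apply: lerXn2r => //; rewrite nnegrE ?expR_ge0// divr_ge0.
  have y4 : (y / 4) ^+ 4 = rate ^+ 4 / 256 * r ^+ 2.
    by rewrite -[in RHS](sqr_sqrtr r0) /y; field.
  have e1 : 1 <= expR y by rewrite -expR0 ler_expR.
  rewrite ler_pdivlMr ?(lt_le_trans _ (oneDsqr_ge1 r))// mulrC.
  rewrite ler_pdivrMr ?expR_gt0// /oneDsqr /c.
  have r4 : 0 < rate ^+ 4 by exact: exprn_gt0.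
  have h4 : r ^+ 2 <= 256 / rate ^+ 4 * expR y.
    have -> : r ^+ 2 = 256 / rate ^+ 4 * (rate ^+ 4 / 256 * r ^+ 2).
      by field; rewrite gt_eqF.
    by rewrite -y4 ler_wpM2l// divr_ge0// ltW.
  by rewrite mulrDl mul1r lerD.
have mo : measurable_fun (`[0%R, +oo[%classic : set (measurableTypeR R))
    (fun r => ((oneDsqr r)^-1)%:E).
  apply/measurable_EFinP/measurable_funTS.
  by apply: continuous_measurable_fun; exact: continuous_oneDsqrV.
have o0 (r : measurableTypeR R) : [set` `[0%R, +oo[] r -> (0 <= ((oneDsqr r)^-1)%:E)%E.
  by move=> _; rewrite lee_fin invr_ge0 (le_trans _ (oneDsqr_ge1 r)).
rewrite (ge0_integralZl_EFin _ _ o0 mo c0)//.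
by rewrite integral0y_oneDsqr -EFinM ltry.
Qed.

End moments.
End exponential.

(** The identity on the real line carrying the exponential law is a variable with this law, to which
    the moment lemmas apply. *)
Lemma exponential_law (R : realType) (rate : R) : 0 < rate ->
  exists (nu : probability (measurableTypeR R) R) (r : R),
  [/\ forall B, nu B = exponential_prob rate B,
      nu `]-oo, 0[%classic = 0%E,
      (\int[nu]_(x in `[0%R, +oo[) x%:E = (rate^-1)%:E)%E &
      (\int[nu]_(x in `[0%R, +oo[) (x ^+ 2)%:E = r%:E)%E].
Proof.
move=> rate0.
pose nu0 := (exponential_prob rate : probability (measurableTypeR R) R).
pose nu := nu0 rate0.
have nuE B : nu B = exponential_prob rate B by [].
have nu_lt0 : nu `]-oo, 0[%classic = 0%E by rewrite nuE exponential_prob_lt0.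
have mid : measurable_fun [set: measurableTypeR R] (idfun : measurableTypeR R -> R).
  exact: measurable_id.
pose X : {RV nu >-> R} :=
  @mfun_Sub _ _ (measurableTypeR R) R idfun (mem_set mid).
have X_exp (B : set R) : measurable B -> distribution nu X B = exponential_prob rate B.
  by move=> _; rewrite -nuE; congr (nu _).
have [r r2] := exponential_moment2_fin rate0 X_exp.
have mX : measurable_fun [set: R] (fun x : R => Num.max x 0) by exact: measurable_maxr.
exists nu, r; split => //.
- rewrite -(exponential_mean rate0 X_exp).
  rewrite (integral_nneg_support nu_lt0) => //; last by move=> x; rewrite le_max lexx orbT.
  apply: eq_integral => x /set_mem/=; rewrite in_itv/= andbT => x0.
  by rewrite max_l.
- rewrite -r2 (integral_nneg_support nu_lt0 (f := fun x => Num.max x 0 ^+ 2)).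
  + apply: eq_integral => x /set_mem/=; rewrite in_itv/= andbT => x0.
    by rewrite max_l.
  + exact: measurable_funX.
  + by move=> x; exact: sqr_ge0.
Qed.

(** * Mutual independence as independence of the past *)

Section independence.
Context d (T : measurableType d) (R : realType) (P : probability T R).

Definition generators (X : nat -> T -> R) (k : nat) : set (set T) :=
  \bigcup_(i in `I_k) preimage_set_system [set: T] (X i) measurable.

(** Finite intersections of preimages form a pi-system that generates the past. On it the product
    formula is mutual independence for the indices below [k] together with [k]. *)
Lemma mutually_independent_past (X : nat -> {RV P >-> R}) :
  mutually_independent X -> forall k (A : set T) (B : set R),
  <<s generators (fun i => X i) k >> A -> measurable B ->
  P (A `&` X k @^-1` B) = (P A * P (X k @^-1` B))%E.
Proof.
move=> indX k A B sA mB.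
pose Pi : set (set T) := [set A | exists2 C : nat -> set R,
  (forall i, measurable (C i)) & A = \bigcap_(i in `I_k) X i @^-1` C i].
have mXC i (C : set R) : measurable C -> measurable (X i @^-1` C).
  by move=> mC; rewrite -[X in measurable X]setTI; exact: measurable_funP.
have mPi : Pi `<=` measurable.
  move=> _ [C mC ->]; rewrite bigcap_mkord; apply: bigsetI_measurable => i _.
  exact: mXC.
have PiT : Pi setT.
  by exists (fun=> setT) => //; apply/seteqP; split.
have PiI : setI_closed Pi.
  move=> _ _ [C1 mC1 ->] [C2 mC2 ->]; exists (fun i => C1 i `&` C2 i).
    by move=> i; exact: measurableI.
  by rewrite -bigcapI; apply: eq_bigcapr.
have genPi : generators (fun i => X i) k `<=` Pi.
  move=> _ [i /= ik [C mC <-]]; exists (fun j => if j == i then C else setT).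
    by move=> j; case: ifP.
  apply/seteqP; split => w /=.
    by move=> [_ XC] j jk; case: eqP => // ->.
  by move=> /(_ i ik); rewrite eqxx.
have {}sA : <<s Pi >> A by apply: sub_smallest2r sA; [exact: smallest_sigma_algebra|].
have mk := mXC k B mB.
have PB0 : 0 <= fine (P (X k @^-1` B)) by rewrite fine_ge0.
pose m1 : {measure set T -> \bar R} := mrestr P mk.
pose m2 : {measure set T -> \bar R} := mscale (NngNum PB0) P.
have m2E C : m2 C = (P C * P (X k @^-1` B))%E.
  by rewrite /m2/= /mscale/= muleC fineK// fin_num_measure.
rewrite -m2E -[LHS]/(m1 A).
apply: (g_sigma_algebra_measure_unique Pi mPi (fun=> setT)) => //.
- by rewrite bigcup_const.
- move=> _ [C mC ->]; rewrite m2E /m1/= /mrestr.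
  pose J := [fset x in iota 0 k]%fset.
  pose C' i := if i == k then B else C i.
  have JE i : (i \in J) = (i < k)%N by rewrite !inE mem_iota.
  have kJ : k \notin J by rewrite JE ltnn.
  have C'E i : (i < k)%N -> C' i = C i by rewrite /C'; case: eqP => // ->; rewrite ltnn.
  have mC' i : measurable (C' i) by rewrite /C'; case: ifP.
  have e1 : \bigcap_(i in `I_k) X i @^-1` C i = \bigcap_(i in [set` J]) X i @^-1` C' i.
    apply/seteqP; split => w h i /=.
      by rewrite JE => ik; have := h i ik; rewrite /= C'E.
    by move=> ik; have := h i; rewrite /= JE C'E//; apply.
  have e2 : \bigcap_(i in `I_k) X i @^-1` C i `&` X k @^-1` B =
      \bigcap_(i in [set` (k |` J)%fset]) X i @^-1` C' i.
    rewrite e1; apply/seteqP; split => w.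
      move=> [h hk] i /=; rewrite in_fset1U => /orP[/eqP->|iJ]; last exact: h.
      by rewrite /C' eqxx.
    move=> h; split.
      by move=> i iJ; apply: h; rewrite /= in_fset1U iJ orbT.
    have := h k; rewrite /= in_fset1U eqxx /C' eqxx; exact.
  rewrite e2 e1 !indX// big_fsetU1//= muleC.
  by rewrite {2}/C' eqxx.
- by move=> _; rewrite /= /m1/= /mrestr setTI (le_lt_trans (probability_le1 P mk))// ltry.
Qed.

End independence.

(** Turns the truncated subtraction in [hub_state] into a real maximum, whose measurability is
    standard. *)
Lemma natrB_max (R : realDomainType) (a b : nat) :
  (a - b)%N%:R = Num.max (a%:R - b%:R) 0 :> R.
Proof.
have [ab|ba] := leqP a b.
  by rewrite (eqP ab) max_r// subr_le0 ler_nat.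
by rewrite natrB 1?ltnW// max_l// subr_ge0 ler_nat ltnW.
Qed.

Lemma measurable_nat_ltr d (T : measurableType d) (R : realType) (f g : T -> R) :
  measurable_fun [set: T] f -> measurable_fun [set: T] g ->
  measurable_fun [set: T] (fun w => (f w < g w)%R%:R : R).
Proof.
move=> mf mg.
rewrite (_ : (fun w => _) = \1_[set w | f w < g w]); last first.
  apply/funext => w; rewrite indicE; congr (nat_of_bool _)%:R.
  by apply/idP/idP => [h|/set_mem//]; apply/mem_set.
apply: measurable_indic.
rewrite (_ : [set w | f w < g w] = [set w | 0 < g w - f w]); last first.
  by apply/seteqP; split => w /=; rewrite subr_gt0.
exact/measurable_gtr_set/measurable_funB.
Qed.

(* The recursion defines the completion times from the service times alone, so
   they are measurable for any sigma-algebra that makes these measurable. *)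
Lemma measurable_network d (T : measurableType d) (R : realType) (N k : nat)
    (E C D S : nat -> T -> R) : (0 < N)%N ->
  (forall i w, E i w = hub_start N (E ^~ w) (C ^~ w) i + D i w) ->
  (forall i w, C i w = satellite_start (E ^~ w) (C ^~ w) i + S i w) ->
  (forall i, (i < k)%N -> measurable_fun [set: T] (D i)) ->
  (forall i, measurable_fun [set: T] (S i)) ->
  forall i, (i <= k)%N ->
  measurable_fun [set: T] (fun w => (hub_state N (E ^~ w) (C ^~ w) i)%:R : R).
Proof.
move=> N0 ED CS mD mS.
pose start i := fun w => hub_start N (E ^~ w) (C ^~ w) i.
have mstart i : (forall j, (j < i)%N ->
    measurable_fun [set: T] (E j) /\ measurable_fun [set: T] (C j)) ->
    measurable_fun [set: T] (start i).
  move=> IH; rewrite /start /hub_start; apply: measurable_maxr.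
    by case: i IH => [|i] IH; [exact: measurable_cst|have [] := IH i (ltnSn i)].
  by case: ltnP => Ni; [exact: measurable_cst|have [] := IH (i - N)%N ltac:(lia)].
have mEC i : (i < k)%N -> forall j, (j <= i)%N ->
    measurable_fun [set: T] (E j) /\ measurable_fun [set: T] (C j).
  move=> ik; elim/ltn_ind => j IH ji.
  have mE : measurable_fun [set: T] (E j).
    rewrite (_ : E j = fun w => start j w + D j w); last exact/funext/ED.
    apply: measurable_funD; last by apply: mD; lia.
    by apply: mstart => l lj; apply: IH => //; lia.
  split=> //.
  rewrite (_ : C j = fun w => satellite_start (E ^~ w) (C ^~ w) j + S j w); last exact/funext/CS.
  apply: measurable_funD => //; rewrite /satellite_start; apply: measurable_maxr => //.
  case: j IH ji {mE} => [|j] IH ji; first exact: measurable_cst.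
  by have [] := IH j (ltnSn j) ltac:(lia).
move=> i ik.
have mEC' j : (j < i)%N -> measurable_fun [set: T] (E j) /\ measurable_fun [set: T] (C j).
  by move=> ji; apply: (mEC j) => //; lia.
rewrite (_ : (fun w => _) = fun w =>
    Num.max (N%:R - \sum_(j < i) (start i w < C j w)%R%:R) 0); last first.
  by apply/funext => w; rewrite /hub_state natrB_max natr_sum.
apply: measurable_maxr => //; apply: measurable_funB => //.
apply: measurable_sum => j; apply: measurable_nat_ltr; first exact: mstart.
by have [] := mEC' j (ltn_ord j).
Qed.

(** * The normalized services form i.i.d. sequences *)

Section network.
Context d (T : measurableType d) (R : realType) (P : probability T R).
Variables (G : R -> R) (mu : R) (N : nat) (D S : nat -> {RV P >-> R}).
Variables (E C : nat -> T -> R).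
Hypothesis mu_gt0 : 0 < mu.
Hypothesis N_gt0 : (0 < N)%N.
Hypothesis net : closed_network G mu N D S E C.

Let N_gt0R : 0 < N%:R :> R. Proof. by rewrite ltr0n. Qed.

(** Multiplication by [N] turns the rate [mu * N] into [mu], giving one law for all networks. *)
Lemma satellite_iid (nu : probability (measurableTypeR R) R) :
  (forall B, nu B = exponential_prob mu B) ->
  iid_filtration P nu (generators (fun i => S i)) (fun k w => N%:R * S k w).
Proof.
move=> nuE.
have muN : 0 < mu * N%:R by exact: mulr_gt0.
have mNS k : measurable_fun [set: T] (fun w => N%:R * S k w).
  by apply: measurable_funM => //; exact: measurable_funP.
have mB' (B : set R) : measurable B -> measurable ((fun x => N%:R * x) @^-1` B).
  move=> mB; rewrite -[X in measurable X]setTI.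
  have : measurable_fun [set: R] (fun x => N%:R * x) by exact: measurable_funM.
  exact.
split => // [i k B ik mB|k A B sA mB].
  apply: sub_sigma_algebra; exists i => //.
  exists ((fun x => N%:R * x) @^-1` B); first exact: mB'.
  by rewrite setTI.
rewrite -[(fun w => N%:R * S k w) @^-1` B]/(S k @^-1` ((fun x => N%:R * x) @^-1` B)).
rewrite (mutually_independent_past (satellite_independent net) sA (mB' _ mB)).
congr (_ * _)%E.
have PT : P [set: T] = 1%E by exact: probability_setT.
suff h x : P (setT `&` [set w | N%:R * S k w <= x]) = (P setT * nu `]-oo, x]%classic)%E.
  by have := indep_halfline (mNS k) measurableT h mB; rewrite setTI PT mul1e.
rewrite PT mul1e setTI nuE exponential_cdf//.
have -> : P [set w | N%:R * S k w <= x] = distribution P (S k) `]-oo, x / N%:R].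
  congr (P _); apply/seteqP; split => w /=; rewrite in_itv/=.
    by rewrite ler_pdivlMr// mulrC.
  by rewrite ler_pdivlMr// mulrC.
rewrite (satellite_exponential net)// exponential_cdf//.
rewrite pmulr_lge0 ?invr_gt0//.
have -> // : - (mu * N%:R) * (x / N%:R) = - mu * x by field; rewrite gt_eqF.
Qed.

Lemma satellite_service_ge0 : {ae P, forall w, forall k, 0 <= S k w}.
Proof.
apply: ae_foralln => k; exists (S k @^-1` `]-oo, 0[); split.
- by rewrite -[X in measurable X]setTI; exact: measurable_funP.
- rewrite -[LHS]/(distribution P (S k) `]-oo, 0[).
  by rewrite (satellite_exponential net)// exponential_prob_lt0.
- by move=> w /= /negP; rewrite -ltNge in_itv.
Qed.

Definition past_generators (k : nat) : set (set T) :=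
  (\bigcup_(i in `I_k) preimage_set_system [set: T] (D i) measurable) `|`
  (\bigcup_j preimage_set_system [set: T] (S j) measurable).

Let past_sub_measurable k A : past D S k A -> measurable A.
Proof.
apply: smallest_sub => [|B]; first exact: sigma_algebra_measurable.
move=> [[i _ [B' mB' <-]]|[j _ [B' mB' <-]]]; exact: measurable_funP.
Qed.

Hypothesis G_positive : G 0 = 0.

Lemma hub_service_gt0 : {ae P, forall w, forall k, 0 < D k w}.
Proof.
apply: ae_foralln => k; exists [set w | D k w <= 0]; split.
- rewrite -[X in measurable X]setTI (_ : [set w | D k w <= 0] = D k @^-1` `]-oo, 0]).
    exact: measurable_funP.
  by apply/seteqP; split => w /=; rewrite in_itv.
- have sT : past D S k setT.
    rewrite /past -[X in <<s _ >> X](@setD0 _ setT); apply: sigma_algebraCD.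
    exact: sigma_algebra0.
  have := hub_conditional_law net 0 sT; rewrite setTI => h.
  apply: etrans h _.
  by rewrite integral0_eq// => w _; rewrite mulr0 G_positive.
- by move=> w /= /negP; rewrite -leNgt.
Qed.

Let work k w := hub_work N (E ^~ w) (C ^~ w) (D ^~ w) k.

Lemma measurable_past k i : (i < k)%N ->
  measurable_fun [set: g_sigma_algebraType (past_generators k)] (D i).
Proof.
move=> ik _ B mB; apply: sub_sigma_algebra; left; exists i => //.
by exists B.
Qed.

Lemma measurable_past_state k i : (i <= k)%N ->
  measurable_fun [set: g_sigma_algebraType (past_generators k)]
    (fun w => (hub_state N (E ^~ w) (C ^~ w) i)%:R : R).
Proof.
apply: (@measurable_network _ (g_sigma_algebraType (past_generators k)) R N k
  E C (fun i => D i) (fun i => S i) N_gt0 (hub_completion net) (satellite_completion net)).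
  by move=> j; exact: measurable_past.
by move=> j _ B mB; apply: sub_sigma_algebra; right; exists j => //; exists B.
Qed.

(** The state [K] at the start of service [k] is determined by the past. On the past event [K = n]
    the service time has distribution function [x |-> G (n x)], so [n * D k] has law [G] whatever
    [n] is; summing over [n] gives independence of the past. *)
Lemma hub_iid (nu : probability (measurableTypeR R) R) :
  (forall x, nu `]-oo, x]%classic = (G x)%:E) ->
  iid_filtration P nu past_generators work.
Proof.
move=> nuG.
have past_preimage k (f : T -> R) (B : set R) :
    measurable_fun [set: g_sigma_algebraType (past_generators k)] f ->
    measurable B -> past D S k (f @^-1` B).
  by move=> mf mB; have := mf measurableT B mB; rewrite setTI.
have adapted i k (B : set R) : (i < k)%N -> measurable B -> past D S k (work i @^-1` B).
  move=> ik; apply: past_preimage; apply: measurable_funM.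
    by apply: measurable_past_state; exact: ltnW.
  exact: measurable_past.
have mwork k : measurable_fun [set: T] (work k).
  move=> _ B mB; rewrite setTI; apply: past_sub_measurable.
  exact: adapted (ltnSn k) mB.
split => // k A B sA mB; have mA := past_sub_measurable sA.
apply: indep_halfline => // {B mB} x.
pose K w := hub_state N (E ^~ w) (C ^~ w) k.
pose A_ n := A `&` [set w | K w = n].
have sA_ n : past D S k (A_ n).
  have := past_preimage k _ [set n%:R : R] (measurable_past_state (leqnn k)) (measurable_set1 _).
  rewrite (_ : _ @^-1` _ = [set w | K w = n]); last first.
    by apply/seteqP; split => w /=; [move/eqP; rewrite eqr_nat => /eqP|move=> <-].
  move=> sK.
  have := @measurableI _ (g_sigma_algebraType (past_generators k)) A _ sA sK.
  exact.
have mA_ n := past_sub_measurable (sA_ n).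
have AE : A = \bigcup_n A_ n.
  by apply/seteqP; split => [w Aw|w [n _ []]//]; exists (K w).
have trivA : trivIset setT A_.
  by move=> i j _ _ [w [[_ /= <-] [_ /= <-]]].
have mx : measurable [set w | work k w <= x].
  rewrite -[X in measurable X]setTI (_ : [set w | work k w <= x] = work k @^-1` `]-oo, x]).
    exact: mwork.
  by apply/seteqP; split => w /=; rewrite in_itv.
have PAx n : P (A_ n `&` [set w | work k w <= x]) = (P (A_ n) * (G x)%:E)%E.
  (* [K = 0] is possible only where some satellite service time is negative, a null event. *)
  case: n => [|n].
    have P0 : P (A_ 0%N) = 0%E.
      apply: measure_negligible => //.
      apply: negligibleS satellite_service_ge0 => w [_ /= K0] /= S0.
      have := @hub_state_gt0 _ N (E ^~ w) (C ^~ w) (fun k => S k w) N_gt0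
        (fun k => satellite_completion net k w) S0 k.
      by rewrite -/(K w) K0.
    rewrite P0 mul0e; apply/eqP; rewrite -measure_le0 -P0.
    by apply: le_measure; rewrite ?inE//; exact: measurableI.
  have -> : A_ n.+1 `&` [set w | work k w <= x] =
            A_ n.+1 `&` [set w | D k w <= x / n.+1%:R].
    have e w : K w = n.+1 -> (work k w <= x) = (D k w <= x / n.+1%:R).
      by move=> Kw; rewrite /work /hub_work -/(K w) Kw ler_pdivlMr// mulrC.
    apply/seteqP; split=> w /=.
      by move=> [[Aw Kw]]; rewrite e.
    by move=> [[Aw Kw]]; rewrite -e.
  rewrite (hub_conditional_law net)//.
  (* On [A_ n.+1] the integrand is the constant [G (n.+1 * (x / n.+1))]. *)
  rewrite (eq_integral (fun=> (G x)%:E)).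
    by rewrite integral_cst// muleC.
  move=> w /set_mem[_ /= Kw]; rewrite -/(K w) Kw mulrC divfK//.
rewrite nuG [in LHS]AE setI_bigcupl measure_bigcup//.
- rewrite [in RHS]AE measure_bigcup// muleC -nneseriesZl//.
  by apply: eq_eseriesr => n _; rewrite [RHS]muleC; exact: PAx.
- by move=> n _; exact: measurableI.
- exact: trivIset_setIr.
Qed.

End network.

Lemma cvg_uniform_dist (R : realType) (F : nat -> R -> R) (f : R -> R) (A : set R) :
  (forall e : R, 0 < e -> \forall N \near \oo, forall t, A t -> `|F N t - f t| < e) ->
  {uniform A, F @ \oo --> f}.
Proof.
move=> h P /uniform_nbhs[U [entU UP]].
have [e /= e0 eU] : exists2 e : R, 0 < e & forall x y : R, `|x - y| < e -> U (x, y).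
  move: entU; rewrite -entourage_ballE => -[e /= e0 eU].
  by exists e => // x y xy; apply: eU.
near=> N; apply: UP => t At; apply: eU; rewrite distrC.
by move: t At; near: N; exact: h.
Unshelve. all: end_near. Qed.

(** * Almost sure uniform convergence to the fluid limit *)

Section fluid_limit.
Context (R : realType) (lambda mu r : R) (G : cumulativeBounded (0 : R) (1 : R)).
Hypotheses (mu_gt0 : 0 < mu) (bottleneck : mu < lambda).
Hypothesis G_positive : G 0 = 0.
Hypothesis G_mean : (\int[lebesgue_stieltjes_measure G]_(x in `[0%R, +oo[) x%:E
               = (1 / lambda)%:E)%E.
Hypothesis G_moment2 : (\int[lebesgue_stieltjes_measure G]_(x in `[0%R, +oo[)
                    (x ^+ 2)%:E = r%:E)%E.
Context d (T : measurableType d) (P : probability T R).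
Variables (D S : nat -> nat -> {RV P >-> R}) (E C : nat -> nat -> T -> R).
Hypothesis network : forall N : nat, (1 <= N)%N ->
       closed_network G mu N (D N) (S N) (E N) (C N).

Let lambda_gt0 : 0 < lambda. Proof. exact: lt_trans bottleneck. Qed.

Let nuG : probability (measurableTypeR R) R := lebesgue_stieltjes_measure G.

Let nuG_cdf (x : R) : nuG `]-oo, x]%classic = (G x)%:E.
Proof. exact: cdf_lebesgue_stieltjes_id. Qed.

Let nuG_lt0 : nuG `]-oo, 0[%classic = 0%E.
Proof.
have nuG0 : nuG `]-oo, 0]%classic = 0%E by rewrite nuG_cdf G_positive.
apply/eqP; rewrite -measure_le0 -nuG0; apply: le_measure; rewrite ?inE//.
by move=> x /=; rewrite !in_itv/=; exact: ltW.
Qed.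

Lemma ae_satellite_fraction_cvg :
  {ae P, forall w, forall U e : R, 0 <= U -> 0 < e -> \forall N \near \oo,
    forall t, 0 <= t <= U ->
    `|satellite_fraction N (E N ^~ w) (C N ^~ w) t - fluid_satellite lambda mu t| < e}.
Proof.
have [nuS [rS [nuSE nuS_lt0 nuS_mean nuS_moment2]]] := exponential_law mu_gt0.
have eps0 n : 0 < (n.+1%:R)^-1 :> R by rewrite invr_gt0.
(* Tying [L = n] to the precision [1 / (n + 1)] lets one countable intersection serve all horizons
   and all tolerances. *)
have hub := ae_foralln (fun n => complete_convergence nuG_lt0 G_mean G_moment2
  (G := fun N => past_generators (D N) (S N))
  (X := fun N k w => hub_work N (E N ^~ w) (C N ^~ w) (D N ^~ w) k) n (eps0 n)
  (fun N N0 => hub_iid N0 (network N0) nuG_cdf)).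
have sat := ae_foralln (fun n => complete_convergence nuS_lt0 nuS_mean nuS_moment2
  (G := fun N => generators (fun i => S N i))
  (X := fun N k w => N%:R * S N k w) n (eps0 n)
  (fun N N0 => satellite_iid mu_gt0 N0 (network N0) nuSE)).
have Dpos := ae_foralln (fun N => hub_service_gt0 (network (ltn0Sn N)) G_positive).
have Spos := ae_foralln (fun N => satellite_service_ge0 (network (ltn0Sn N))).
have pos : {ae P, forall w, (forall N k, 0 < D N.+1 k w) /\
    (forall N k, 0 <= S N.+1 k w)}.
  by move: Dpos Spos; apply: filterS2 => w; exact: conj.
move: hub sat pos; apply: filterS3 => w hub sat [{}Dpos {}Spos] U e U0 e0.
pose c := fluid_error lambda mu.
have c0 : 0 < c.
  rewrite /c /fluid_error; cbv zeta.
  have c2 : 0 < 2 * (1 + 2 * lambda) / mu.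
    by rewrite divr_gt0// mulr_gt0// addr_gt0// mulr_gt0.
  set c2' := 2 * (1 + 2 * lambda) / mu in c2 *.
  have h1 : 0 < lambda * c2' by exact: mulr_gt0.
  have h2 : 0 < mu * c2' by exact: mulr_gt0.
  by move: lambda_gt0 mu_gt0 h1 h2; lra.
(* An [n] above [b1] brings the error below [e], above [b2] it gives [eps_small], and above [b3] it
   makes [n * N] hub services outlast the horizon [U]. *)
pose b1 := c / e; pose b2 := (2 * lambda + 2 * mu + 2) * (2 * lambda) / mu.
pose b3 := lambda * (U + 1).
have b10 : 0 <= b1 by rewrite divr_ge0// ltW.
have b20 : 0 <= b2.
  have h : 0 < 2 * lambda + 2 * mu + 2 by move: lambda_gt0 mu_gt0; lra.
  by apply/ltW/divr_gt0 => //; apply: mulr_gt0 => //; exact: mulr_gt0.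
have b30 : 0 <= b3 by rewrite mulr_ge0 ?addr_ge0// ltW.
pose n := (Num.truncn (b1 + b2 + b3)).+1.
have bn : b1 + b2 + b3 < n%:R by exact: truncnS_gt.
pose eps : R := n.+1%:R^-1.
have n1 : n.+1%:R = n%:R + 1 :> R by rewrite natr1.
have n10 : 0 < n.+1%:R :> R by [].
have eps1 : eps <= 1 by rewrite invf_le1// ler1n.
have ceps : c * eps < e.
  by rewrite /eps ltr_pdivrMr// mulrC -ltr_pdivrMr// -/b1 n1; lra.
have eps_small : (2 * lambda + 2 * mu + 2) * eps <= mu / (2 * lambda).
  rewrite /eps ler_pdivrMr// mulrAC ler_pdivlMr ?mulr_gt0// mulrC.
  by rewrite (mulrC mu) -ler_pdivrMr// n1 mulrC -/b2; lra.
near=> N => t tU.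
have N0 : (0 < N)%N by near: N; exact: nbhs_infty_gt.
have N0R : 0 < N%:R :> R by rewrite ltr0n.
have epsN : 1 <= eps * N%:R.
  by rewrite /eps mulrC ler_pdivlMr// mul1r ler_nat; near: N; exact: nbhs_infty_ge.
apply: le_lt_trans ceps.
have net := network N0.
have hubN : forall k, (k <= n * N)%N ->
    `|\sum_(i < k) hub_work N (E N ^~ w) (C N ^~ w) (D N ^~ w) i - k%:R / lambda|
      <= eps * N%:R.
  by move=> k kM; rewrite -[lambda^-1]mul1r; move: k kM; near: N; exact: hub.
have satN : forall k, (k <= n * N)%N ->
    `|\sum_(i < k) N%:R * S N i w - k%:R / mu| <= eps * N%:R.
  by near: N; exact: sat.
apply: (satellite_fraction_fluid N (E N ^~ w) (C N ^~ w) (D N ^~ w) (S N ^~ w) N0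
  (hub_completion net ^~ w) (satellite_completion net ^~ w) _ _ lambda mu (n * N)
  eps mu_gt0 bottleneck hubN _ epsN eps_small U t _ tU).
- by move=> k; have := Dpos N.-1 k; rewrite prednK.
- by move=> k; have := Spos N.-1 k; rewrite prednK.
- move=> k /satN; rewrite -mulr_sumr.
  have -> : N%:R * (\sum_(i < k) S N i w) - k%:R / mu =
     N%:R * (\sum_(i < k) S N i w - k%:R / (mu * N%:R)).
    by field; rewrite !gt_eqF.
  by rewrite normrM gtr0_norm// mulrC ler_pM2r.
- rewrite natrM mulrAC ltr_pM2r//.
  have : lambda * (U + eps) <= b3 by rewrite /b3 ler_pM2l// lerD2l.
  lra.
Unshelve. all: end_near. Qed.

End fluid_limit.

Unset Implicit Arguments.

Theorem mainTheorem1 (R : realType) (lambda mu r : R)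
    (G : cumulativeBounded (0 : R) (1 : R))
    (lambda_gt0 : 0 < lambda) (mu_gt0 : 0 < mu)
    (G_positive : G 0 = 0)
    (G_mean : (\int[lebesgue_stieltjes_measure G]_(x in `[0%R, +oo[) x%:E
               = (1 / lambda)%:E)%E)
    (G_moment2 : (\int[lebesgue_stieltjes_measure G]_(x in `[0%R, +oo[)
                    (x ^+ 2)%:E = r%:E)%E)
    (r_gt : 2 / lambda ^+ 2 < r)
    (d : measure_display) (T : measurableType d) (P : probability T R)
    (D S : nat -> nat -> {RV P >-> R}) (E C : nat -> nat -> T -> R)
    (network : forall N : nat, (1 <= N)%N ->
       closed_network G mu N (D N) (S N) (E N) (C N))
    (bottleneck : mu < lambda) :
  let qbar (N : nat) (t : R) (w : T) : R :=
    hub_fraction N (E N ^~ w) (C N ^~ w) t in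
  let q (N : nat) (t : R) (w : T) : R :=
    satellite_fraction N (E N ^~ w) (C N ^~ w) t in
  let qbar_lim (t : R) : R :=
    1 - (lambda - mu) / lambda * (1 - expR (- (lambda * t))) in
  let q_lim (t : R) : R :=
    (1 - mu / lambda) * (1 - expR (- (lambda * t))) in
  [/\ forall t : R, 0 <= t ->
        {ae P, forall w, qbar N t w @[N --> \oo] --> qbar_lim t},
      forall t : R, 0 <= t ->
        {ae P, forall w, q N t w @[N --> \oo] --> q_lim t},
      {ae P, forall w, forall A : set R,
        A `<=` [set t | 0 <= t] -> bounded_set A ->
        {uniform A, (fun (N : nat) (t : R) => qbar N t w) @ \oo --> qbar_lim}}
    & {ae P, forall w, forall A : set R,
        A `<=` [set t | 0 <= t] -> bounded_set A ->
        {uniform A, (fun (N : nat) (t : R) => q N t w) @ \oo --> q_lim}}].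
Proof.
move=> qbar q qbar_lim q_lim.
have cvq := ae_satellite_fraction_cvg mu_gt0 bottleneck G_positive G_mean G_moment2 network.
have uq : {ae P, forall w, forall A : set R,
    A `<=` [set t | 0 <= t] -> bounded_set A ->
    {uniform A, (fun (N : nat) (t : R) => q N t w) @ \oo --> q_lim}}.
  move: cvq; apply: filterS => w cvw A A0 [M [_ MA]].
  apply: cvg_uniform_dist => e e0.
  have U0 : 0 <= `|M| + 1 by rewrite addr_ge0.
  have := cvw _ _ U0 e0; apply: filterS => N h t At; apply: h.
  rewrite (A0 t At)/=; apply: le_trans (ler_norm t) _.
  by apply: MA At; rewrite (le_lt_trans (ler_norm M))// ltrDl.
have uqbar : {ae P, forall w, forall A : set R,
    A `<=` [set t | 0 <= t] -> bounded_set A ->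
    {uniform A, (fun (N : nat) (t : R) => qbar N t w) @ \oo --> qbar_lim}}.
  move: cvq; apply: filterS => w cvw A A0 [M [_ MA]].
  apply: cvg_uniform_dist => e e0.
  have U0 : 0 <= `|M| + 1 by rewrite addr_ge0.
  near=> N => t At.
  have N0 : N%:R != 0 :> R by rewrite pnatr_eq0 -lt0n; near: N; exact: nbhs_infty_gt.
  have -> : qbar N t w - qbar_lim t = - (q N t w - q_lim t).
    rewrite /qbar /q /hub_fraction /satellite_fraction /qbar_lim /q_lim.
    by field; rewrite N0 gt_eqF.
  rewrite normrN; move: t At; near: N.
  have := cvw _ _ U0 e0; apply: filterS => N h t At; apply: h.
  rewrite (A0 t At)/=; apply: le_trans (ler_norm t) _.
  by apply: MA At; rewrite (le_lt_trans (ler_norm M))// ltrDl.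
(* Pointwise convergence is uniform convergence on a singleton. *)
have bs (t : R) : bounded_set [set t].
  by exists `|t|; split => // y ty _ ->; exact: ltW.
split => //.
- move=> t t0; move: uqbar; apply: filterS => w /(_ [set t]) h.
  have {}h := h ltac:(by move=> _ ->) (bs t).
  by rewrite uniform_set1 in h.
- move=> t t0; move: uq; apply: filterS => w /(_ [set t]) h.
  have {}h := h ltac:(by move=> _ ->) (bs t).
  by rewrite uniform_set1 in h.
Unshelve. all: end_near. Qed.
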